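(* Let $\mathcal L$: $u_t=A(t,x)u_{xx}+B(t,x)u_x+C(t,x)u$ with analytic $A,B,C$, $A\ne0$, and let a reduction operator $Q$ of $\mathcal L$ be associated, up to the equivalence relation of operators, with a first-order linear differential operator acting on functions of $t$ and $x$. Then $Q$ is equivalent to a Darboux operator constructed with one (resp. two) linearly independent solutions of $\mathcal L$ in the case of vanishing (resp. nonvanishing) coefficient of $\partial_t$ in $Q$.
   Context: All considerations are local: functions are smooth (or analytic) on a suitable domain, which may be shrunk so that expressions not vanishing identically do not vanish. Write $Lu:=u_t-Au_{xx}-Bu_x-Cu$. A reduction operator of $\mathcal L$ is an operator $Q=\tau\partial_t+\xi\partial_x+\eta\partial_u$ with coefficients depending on $(t,x,u)$, $(\tau,\xi)\ne(0,0)$, such that $Q_{(2)}(Lu)=0$ on the subset of the second-order jet space defined by $Lu=0$, $Q[u]=0$, $D_tQ[u]=0$, $D_xQ[u]=0$, where $Q[u]=\eta-\tau u_t-\xi u_x$, $Q_{(2)}$ is the second prolongation of $Q$, and $D_t,D_x$ are total derivatives. Two operators are equivalent if they differ by a nonvanishing multiplier $\lambda(t,x,u)$. $Q$ is associated (up to equivalence) with a first-order linear differential operator $\widetilde Q$ acting on functions of $(t,x)$ if $Q$ is equivalent to an operator of the form $\partial_t+g^1(t,x)\partial_x+g^2(t,x)u\partial_u$ (then $\widetilde Q=-\partial_t-g^1\partial_x+g^2$) or of the form $\partial_x+\eta^1(t,x)u\partial_u$ (then $\widetilde Q=-\partial_x+\eta^1$). For functions $\psi^1,\dots,\psi^p$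 of $(t,x)$, the Darboux operator is ${\rm DT}[\psi^1,\dots,\psi^p]u=W(\psi^1,\dots,\psi^p,u)/W(\psi^1,\dots,\psi^p)$, where $W$ denotes the Wronskian with respect to $x$. In particular ${\rm DT}[\psi]=\partial_x-\psi_x/\psi$ and $${\rm DT}[\psi^1,\psi^2]=\partial_{xx}-\frac{(W(\psi^1,\psi^2))_x}{W(\psi^1,\psi^2)}\partial_x+\frac{W(\psi^1_x,\psi^2_x)}{W(\psi^1,\psi^2)}.$$ That $Q$ is equivalent to a Darboux operator means that $\widetilde Q$ coincides, on the solution set of $\mathcal L$ and up to a nonvanishing multiplier that is a function of $(t,x)$, with that Darboux operator. *)

(* Defs.v *)
From Stdlib Require Export Reals List Arith.
From Coquelicot Require Export Coquelicot.
Export ListNotations.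
Open Scope R_scope.

Definition smooth2 (D : R * R -> Prop) (f : R -> R -> R) : Prop :=
  forall (n : nat) (t x : R), D (t, x) -> ex_diff_n f n t x.

(* Three-variable analogue of Coquelicot's [ex_diff_n]. *)
Fixpoint ex_diff_n3 (f : R -> R -> R -> R) (n : nat) (t x u : R) : Prop :=
  continuous (fun p : R * R * R => f (fst (fst p)) (snd (fst p)) (snd p))
             (t, x, u) /\
  match n with
  | O => True
  | S n' =>
      ex_derive (fun z => f z x u) t /\
      ex_derive (fun z => f t z u) x /\
      ex_derive (fun z => f t x z) u /\
      ex_diff_n3 (fun t' x' u' => Derive (fun z => f z x' u') t') n' t x u /\
      ex_diff_n3 (fun t' x' u' => Derive (fun z => f t' z u') x') n' t x u /\
      ex_diff_n3 (fun t' x' u' => Derive (fun z => f t' x' z) u') n' t x u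
  end.

Definition smooth3 (Om : R * R * R -> Prop) (f : R -> R -> R -> R) : Prop :=
  forall (n : nat) (t x u : R), Om (t, x, u) -> ex_diff_n3 f n t x u.

(* [DL_pol n f t0 x0] is the Taylor polynomial of total degree [n] at
   [(t0,x0)], as a function of the increments. *)
Definition analytic2 (D : R * R -> Prop) (f : R -> R -> R) : Prop :=
  smooth2 D f /\
  forall t0 x0 : R, D (t0, x0) ->
    exists r : posreal, forall t x : R,
      ball ((t0, x0) : R * R) r (t, x) ->
      is_lim_seq (fun n => DL_pol n f t0 x0 (t - t0) (x - x0)) (f t x).

Definition is_solution (A B C : R -> R -> R) (U : R * R -> Prop)
    (u : R -> R -> R) : Prop :=
  smooth2 U u /\
  forall t x : R, U (t, x) ->
    Derive (fun s => u s x) t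
    = A t x * Derive_n (fun y => u t y) 2 x
      + B t x * Derive (fun y => u t y) x
      + C t x * u t x.

Inductive jvar : Set :=
  | Jt | Jx | Ju | Jut | Jux | Jutt | Jutx | Juxx.

Scheme Equality for jvar.

Definition jet : Type := jvar -> R.

Definition upd (j : jet) (c : jvar) (s : R) : jet :=
  fun c' => if jvar_beq c' c then s else j c'.

Definition pd (c : jvar) (F : jet -> R) (j : jet) : R :=
  Derive (fun s => F (upd j c s)) (j c).

(* The total derivatives are only ever applied to functions that do not depend
   on the second-order coordinates, so the terms with third-order coordinates
   are absent. *)
Definition Dt (F : jet -> R) (j : jet) : R :=
  pd Jt F j + j Jut * pd Ju F j + j Jutt * pd Jut F j + j Jutx * pd Jux F j.

Definition Dx (F : jet -> R) (j : jet) : R :=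
  pd Jx F j + j Jux * pd Ju F j + j Jutx * pd Jut F j + j Juxx * pd Jux F j.

Definition jlift (f : R -> R -> R -> R) (j : jet) : R := f (j Jt) (j Jx) (j Ju).

(* The operator [tau d_t + xi d_x + eta d_u]. *)
Record vfield := VField {
  tau : R -> R -> R -> R;
  xi  : R -> R -> R -> R;
  eta : R -> R -> R -> R
}.

Definition charact (Q : vfield) (j : jet) : R :=
  jlift (eta Q) j - jlift (tau Q) j * j Jut - jlift (xi Q) j * j Jux.

Definition eta_t (Q : vfield) (j : jet) : R :=
  Dt (jlift (eta Q)) j
  - j Jut * Dt (jlift (tau Q)) j - j Jux * Dt (jlift (xi Q)) j.

Definition eta_x (Q : vfield) (j : jet) : R :=
  Dx (jlift (eta Q)) j
  - j Jut * Dx (jlift (tau Q)) j - j Jux * Dx (jlift (xi Q)) j.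

Definition eta_tt (Q : vfield) (j : jet) : R :=
  Dt (eta_t Q) j
  - j Jutt * Dt (jlift (tau Q)) j - j Jutx * Dt (jlift (xi Q)) j.

Definition eta_tx (Q : vfield) (j : jet) : R :=
  Dx (eta_t Q) j
  - j Jutt * Dx (jlift (tau Q)) j - j Jutx * Dx (jlift (xi Q)) j.

Definition eta_xx (Q : vfield) (j : jet) : R :=
  Dx (eta_x Q) j
  - j Jutx * Dx (jlift (tau Q)) j - j Juxx * Dx (jlift (xi Q)) j.

Definition prolong2 (Q : vfield) (F : jet -> R) (j : jet) : R :=
  jlift (tau Q) j * pd Jt F j + jlift (xi Q) j * pd Jx F j
  + jlift (eta Q) j * pd Ju F j
  + eta_t Q j * pd Jut F j + eta_x Q j * pd Jux F j
  + eta_tt Q j * pd Jutt F j + eta_tx Q j * pd Jutx F j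
  + eta_xx Q j * pd Juxx F j.

Definition Ljet (A B C : R -> R -> R) (j : jet) : R :=
  j Jut - A (j Jt) (j Jx) * j Juxx - B (j Jt) (j Jx) * j Jux
  - C (j Jt) (j Jx) * j Ju.

Definition is_reduction_operator (A B C : R -> R -> R)
    (Om : R * R * R -> Prop) (Q : vfield) : Prop :=
  smooth3 Om (tau Q) /\ smooth3 Om (xi Q) /\ smooth3 Om (eta Q) /\
  (forall t x u : R, Om (t, x, u) -> (tau Q t x u, xi Q t x u) <> (0, 0)) /\
  (forall j : jet, Om (j Jt, j Jx, j Ju) ->
     Ljet A B C j = 0 -> charact Q j = 0 ->
     Dt (charact Q) j = 0 -> Dx (charact Q) j = 0 ->
     prolong2 Q (Ljet A B C) j = 0).

Definition vfield_equiv (Om : R * R * R -> Prop) (Q Q' : vfield) : Prop :=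
  exists lam : R -> R -> R -> R,
    smooth3 Om lam /\
    forall t x u : R, Om (t, x, u) ->
      lam t x u <> 0 /\
      tau Q t x u = lam t x u * tau Q' t x u /\
      xi Q t x u = lam t x u * xi Q' t x u /\
      eta Q t x u = lam t x u * eta Q' t x u.

Definition base (Om : R * R * R -> Prop) : R * R -> Prop :=
  fun p => exists u : R, Om (p, u).

(* The operator [c_t d_t + c_x d_x + c_0] on functions of [(t,x)]. *)
Record lop := LOp {
  c_t : R -> R -> R;
  c_x : R -> R -> R;
  c_0 : R -> R -> R
}.

Definition lapply (P : lop) (u : R -> R -> R) (t x : R) : R :=
  c_t P t x * Derive (fun s => u s x) t
  + c_x P t x * Derive (fun y => u t y) x
  + c_0 P t x * u t x.

Definition associated (Om : R * R * R -> Prop) (Q : vfield) (Qt : lop) : Prop :=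
  (exists g1 g2 : R -> R -> R,
     smooth2 (base Om) g1 /\ smooth2 (base Om) g2 /\
     vfield_equiv Om Q
       (VField (fun _ _ _ => 1) (fun t x _ => g1 t x)
               (fun t x u => g2 t x * u)) /\
     forall t x : R, base Om (t, x) ->
       c_t Qt t x = -1 /\ c_x Qt t x = - g1 t x /\ c_0 Qt t x = g2 t x)
  \/
  (exists eta1 : R -> R -> R,
     smooth2 (base Om) eta1 /\
     vfield_equiv Om Q
       (VField (fun _ _ _ => 0) (fun _ _ _ => 1)
               (fun t x u => eta1 t x * u)) /\
     forall t x : R, base Om (t, x) ->
       c_t Qt t x = 0 /\ c_x Qt t x = -1 /\ c_0 Qt t x = eta1 t x).

(* Determinant of [(M i j)], [0 <= i, j < n], by expansion along row 0. *)
Fixpoint det (n : nat) (M : nat -> nat -> R) : R :=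
  match n with
  | O => 1
  | S m =>
      sum_f_R0
        (fun j => (-1) ^ j * M O j *
           det m (fun i k => M (S i) (if Nat.ltb k j then k else S k))) m
  end.

Definition wronskian (fs : list (R -> R -> R)) (t x : R) : R :=
  det (length fs)
    (fun i j => Derive_n (fun y => nth j fs (fun _ _ => 0) t y) i x).

Definition darboux (psis : list (R -> R -> R)) (u : R -> R -> R) (t x : R) : R :=
  wronskian (psis ++ [u]) t x / wronskian psis t x.

Definition lin_indep (U : R * R -> Prop) (fs : list (R -> R -> R)) : Prop :=
  forall c : nat -> R,
    (forall t x : R, U (t, x) ->
       sum_n (fun j => c j * nth j fs (fun _ _ => 0) t x) (pred (length fs)) = 0) ->
    forall j : nat, (j < length fs)%nat -> c j = 0.

(* The test functions range over the solutions on arbitrary open subsets of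
   [U], so that all germs of solutions are taken into account. *)
Definition coincides_with_darboux (A B C : R -> R -> R) (U : R * R -> Prop)
    (Qt : lop) (psis : list (R -> R -> R)) : Prop :=
  exists mu : R -> R -> R,
    smooth2 U mu /\
    (forall t x : R, U (t, x) -> mu t x <> 0) /\
    forall (V : R * R -> Prop) (u : R -> R -> R),
      open V -> (forall p, V p -> U p) -> is_solution A B C V u ->
      forall t x : R, V (t, x) ->
        lapply Qt u t x = mu t x * darboux psis u t x.

(* Near every point of the domain, [Qt] is a Darboux operator constructed with
   [p] linearly independent solutions. *)
Definition locally_darboux (A B C : R -> R -> R) (D : R * R -> Prop)
    (Qt : lop) (p : nat) : Prop :=
  forall t0 x0 : R, D (t0, x0) ->
    exists (r : posreal) (psis : list (R -> R -> R)),
      let U := ball ((t0, x0) : R * R) r in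
      (forall q, U q -> D q) /\
      length psis = p /\
      List.Forall (is_solution A B C U) psis /\
      lin_indep U psis /\
      (forall t x : R, U (t, x) -> wronskian psis t x <> 0) /\
      coincides_with_darboux A B C U Qt psis.

(* Main.v *)
(* Both cases reduce to a linear system [v_x = m v], [v_t = n v].  If
   [Q = d_x + eta1 u d_u], the reduction condition says exactly that
   [psi_x = eta1 psi] and [psi_t = A psi_xx + B psi_x + C psi] are compatible.
   If [Q = d_t + g1 d_x + g2 u d_u], the invariant solutions satisfy
   [psi_t = g2 psi - g1 psi_x] and, after elimination of [psi_t] from the
   equation, [psi_xx = P psi + q psi_x] with [P = (g2 - C) / A] and
   [q = - (g1 + B) / A]; the reduction condition is the flatness of the resulting
   connection on [(psi, psi_x)].  Parallel sections therefore exist with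
   arbitrary initial values, and the Darboux operator of two independent ones is
   [d_xx - q d_x - P], which on solutions of the equation is [- 1 / A] times the
   operator associated with [Q].  Only the smoothness of [A], [B], [C] matters:
   the parallel sections are found by solving linear ordinary differential
   equations, first in [t] along [x = x0], then in [x]. *)

Require Import Defs.
From Stdlib Require Import Lra Lia IndefiniteDescription FunctionalExtensionality.

(** * Smooth functions of two variables *)

(** The delicate point is regularity in [t]. The sections are solved in [x] separately for each [t]
    and collected by a choice principle, so nothing is known beforehand about their dependence on
    [t] away from [x0]. Flatness supplies it: the error of the expected [t]-derivative satisfies a
    linear equation in [x] with small data, and a Gronwall estimate makes it negligible; this costs
    bounds on two [t]-derivatives of [m]. A bounded [x]-derivative then gives joint continuity, and
    the system itself bootstraps this to smoothness.

    Flatness comes out of the reduction condition in two moves. The multiplier [lam], which may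
    depend on [u], is cancelled: where the characteristic and its first total derivatives vanish,
    the condition is homogeneous in [lam]. Then the constraints are solved for explicit jet
    coordinates; what remains is linear in the free ones ([u], and also [u_x] when [tau] is
    nonzero), so the coefficients vanish separately.

    The claim being local, all estimates are made on intervals with [K * r] small, where linear
    bounds replace exponential ones. *)

Definition d_t (f : R -> R -> R) : R -> R -> R :=
  fun t x => Derive (fun s => f s x) t.

Definition d_x (f : R -> R -> R) : R -> R -> R :=
  fun t x => Derive (fun y => f t y) x.

(** Smoothness is graded by order so that closure properties can be proved by induction, each
    derivative costing one order. *)
Definition smoothN (n : nat) (D : R * R -> Prop) (f : R -> R -> R) : Prop :=
  forall t x : R, D (t, x) -> ex_diff_n f n t x.

Lemma open_locally_2d (D : R * R -> Prop) (t x : R) :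
  open D -> D (t, x) -> locally_2d (fun s y => D (s, y)) t x.
Proof.
intros HD H. apply locally_2d_locally.
generalize (HD _ H). apply filter_imp. now intros [s y].
Qed.

Lemma open_locally_x (D : R * R -> Prop) (t x : R) :
  open D -> D (t, x) -> locally x (fun y => D (t, y)).
Proof.
intros HD H.
now apply (locally_2d_1d_const_x (fun s y => D (s, y))), open_locally_2d.
Qed.

Lemma smoothN_le (m n : nat) D f : (m <= n)%nat -> smoothN n D f -> smoothN m D f.
Proof. intros Hmn H t x Dtx. now apply ex_diff_n_m with n; auto. Qed.

Lemma smoothN_ext n D f g : open D ->
  (forall t x, D (t, x) -> f t x = g t x) -> smoothN n D f -> smoothN n D g.
Proof.
intros HD E H t x Dtx. apply ex_diff_n_ext_loc with f; auto.
apply locally_2d_impl with (2 := open_locally_2d D t x HD Dtx).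
apply locally_2d_forall; auto.
Qed.

Lemma smoothN_sub n (D D' : R * R -> Prop) f :
  (forall p, D' p -> D p) -> smoothN n D f -> smoothN n D' f.
Proof. intros E H t x Dtx. apply H; auto. Qed.

(** [ex_diff_n] recurses on [Derive] as a function of both variables. Openness of [D] allows it to
    be replaced by explicit derivatives known only on [D]. *)
Lemma smoothN_S n D f ft fx : open D ->
  (forall t x, D (t, x) -> continuity_2d_pt f t x) ->
  (forall t x, D (t, x) -> is_derive (fun s => f s x) t (ft t x)) ->
  (forall t x, D (t, x) -> is_derive (fun y => f t y) x (fx t x)) ->
  smoothN n D ft -> smoothN n D fx -> smoothN (S n) D f.
Proof.
intros HD Hc Ht Hx Hft Hfx t x Dtx. simpl. repeat split.
- now apply Hc.
- exists (ft t x). now apply Ht.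
- exists (fx t x). now apply Hx.
- apply (smoothN_ext n D ft); auto.
  intros s y Dsy. symmetry. apply is_derive_unique. now apply Ht.
- apply (smoothN_ext n D fx); auto.
  intros s y Dsy. symmetry. apply is_derive_unique. now apply Hx.
Qed.

Lemma smoothN_cont n D f t x : smoothN n D f -> D (t, x) -> continuity_2d_pt f t x.
Proof. intros H Dtx. specialize (H t x Dtx). destruct n; apply H. Qed.

Lemma smoothN_is_derive_t n D f t x : smoothN (S n) D f -> D (t, x) ->
  is_derive (fun s => f s x) t (d_t f t x).
Proof. intros H Dtx. apply Derive_correct. apply (H t x Dtx). Qed.

Lemma smoothN_is_derive_x n D f t x : smoothN (S n) D f -> D (t, x) ->
  is_derive (fun y => f t y) x (d_x f t x).
Proof. intros H Dtx. apply Derive_correct. apply (H t x Dtx). Qed.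

Lemma smoothN_d_t n D f : smoothN (S n) D f -> smoothN n D (d_t f).
Proof. intros H t x Dtx. apply (H t x Dtx). Qed.

Lemma smoothN_d_x n D f : smoothN (S n) D f -> smoothN n D (d_x f).
Proof. intros H t x Dtx. apply (H t x Dtx). Qed.

Lemma smoothN_const n D (c : R) : smoothN n D (fun _ _ => c).
Proof.
revert c. induction n as [|n IH]; intros c t x Dtx; simpl.
- split; [apply continuity_2d_pt_const | easy].
- repeat split.
  + apply continuity_2d_pt_const.
  + apply ex_derive_const.
  + apply ex_derive_const.
  + apply ex_diff_n_ext_loc with (fun _ _ => 0).
    * apply locally_2d_forall; intros; now rewrite Derive_const.
    * now apply IH.
  + apply ex_diff_n_ext_loc with (fun _ _ => 0).
    * apply locally_2d_forall; intros; now rewrite Derive_const.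
    * now apply IH.
Qed.

Lemma smoothN_plus n D f g : open D -> smoothN n D f -> smoothN n D g ->
  smoothN n D (fun t x => f t x + g t x).
Proof.
intros HD. revert f g. induction n as [|n IH]; intros f g Hf Hg.
- intros t x Dtx. split; [|easy].
  apply continuity_2d_pt_plus; [apply (Hf t x Dtx) | apply (Hg t x Dtx)].
- apply smoothN_S with (fun t x => d_t f t x + d_t g t x)
    (fun t x => d_x f t x + d_x g t x); auto.
  + intros t x Dtx. apply continuity_2d_pt_plus;
    [apply (Hf t x Dtx) | apply (Hg t x Dtx)].
  + intros t x Dtx. apply (is_derive_plus (V := R_NormedModule));
    eapply smoothN_is_derive_t; eauto.
  + intros t x Dtx. apply (is_derive_plus (V := R_NormedModule));
    eapply smoothN_is_derive_x; eauto.
  + apply IH; now apply smoothN_d_t.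
  + apply IH; now apply smoothN_d_x.
Qed.

Lemma smoothN_mult n D f g : open D -> smoothN n D f -> smoothN n D g ->
  smoothN n D (fun t x => f t x * g t x).
Proof.
intros HD. revert f g. induction n as [|n IH]; intros f g Hf Hg.
- intros t x Dtx. split; [|easy].
  apply continuity_2d_pt_mult; [apply (Hf t x Dtx) | apply (Hg t x Dtx)].
- assert (Hf' := smoothN_le n (S n) D f (Nat.le_succ_diag_r n) Hf).
  assert (Hg' := smoothN_le n (S n) D g (Nat.le_succ_diag_r n) Hg).
  apply smoothN_S with (fun t x => d_t f t x * g t x + f t x * d_t g t x)
    (fun t x => d_x f t x * g t x + f t x * d_x g t x); auto.
  + intros t x Dtx. apply continuity_2d_pt_mult;
    [apply (Hf t x Dtx) | apply (Hg t x Dtx)].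
  + intros t x Dtx. apply (is_derive_mult (fun s => f s x) (fun s => g s x));
      [eapply smoothN_is_derive_t; eauto | eapply smoothN_is_derive_t; eauto |].
    intros; apply Rmult_comm.
  + intros t x Dtx. apply (is_derive_mult (fun y => f t y) (fun y => g t y));
      [eapply smoothN_is_derive_x; eauto | eapply smoothN_is_derive_x; eauto |].
    intros; apply Rmult_comm.
  + apply smoothN_plus; auto; apply IH; auto; now apply smoothN_d_t.
  + apply smoothN_plus; auto; apply IH; auto; now apply smoothN_d_x.
Qed.

Lemma smoothN_opp n D f : open D -> smoothN n D f -> smoothN n D (fun t x => - f t x).
Proof.
intros HD Hf. apply smoothN_ext with (fun t x => -1 * f t x); auto.
- intros; ring.
- apply smoothN_mult; auto. apply smoothN_const.
Qed.

Lemma smoothN_inv n D f : open D -> (forall t x, D (t, x) -> f t x <> 0) ->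
  smoothN n D f -> smoothN n D (fun t x => / f t x).
Proof.
intros HD Hnz. revert f Hnz. induction n as [|n IH]; intros f Hnz Hf.
- intros t x Dtx. split; [|easy].
  apply continuity_2d_pt_inv; [apply (Hf t x Dtx) | auto].
- assert (Hf' := smoothN_le n (S n) D f (Nat.le_succ_diag_r n) Hf).
  (* Both derivatives are written with the product of two copies of [/ f] rather than a quotient, so
     that the induction hypothesis applies to each copy. *)
  apply smoothN_S with (fun t x => - d_t f t x * (/ f t x * / f t x))
    (fun t x => - d_x f t x * (/ f t x * / f t x)); auto.
  + intros t x Dtx. apply continuity_2d_pt_inv; [apply (Hf t x Dtx) | auto].
  + intros t x Dtx.
    replace (- d_t f t x * (/ f t x * / f t x)) with (- d_t f t x / f t x ^ 2)
      by (field; auto).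
    apply (is_derive_inv (fun s => f s x)); auto.
    eapply smoothN_is_derive_t; eauto.
  + intros t x Dtx.
    replace (- d_x f t x * (/ f t x * / f t x)) with (- d_x f t x / f t x ^ 2)
      by (field; auto).
    apply (is_derive_inv (fun y => f t y)); auto.
    eapply smoothN_is_derive_x; eauto.
  + apply smoothN_mult; auto.
    * apply smoothN_opp; auto. now apply smoothN_d_t.
    * apply smoothN_mult; auto.
  + apply smoothN_mult; auto.
    * apply smoothN_opp; auto. now apply smoothN_d_x.
    * apply smoothN_mult; auto.
Qed.

Lemma smooth2_smoothN D f : smooth2 D f <-> forall n, smoothN n D f.
Proof. split; intros H n t x Dtx; now apply H. Qed.

(** * Linear ordinary differential equations *)

(** Vectors and matrices of size two are indexed by [bool]: indices carry no range conditions, and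
    case analysis reaches every entry. *)
Definition mv (a : bool -> bool -> R) (v : bool -> R) (i : bool) : R :=
  a i true * v true + a i false * v false.

Lemma mv_bound (a : bool -> bool -> R) (v : bool -> R) (K S : R) (i : bool) :
  (forall i j, Rabs (a i j) <= K) -> (forall j, Rabs (v j) <= S) ->
  Rabs (mv a v i) <= 2 * K * S.
Proof.
intros Ha Hv.
assert (H : forall j, Rabs (a i j * v j) <= K * S).
{ intros j. rewrite Rabs_mult.
  apply Rmult_le_compat; auto using Rabs_pos. }
unfold mv. generalize (H true) (H false).
generalize (Rabs_triang (a i true * v true) (a i false * v false)). lra.
Qed.

(* The maximum of [|E true| + |E false|] over the interval between the center
   and [x] is at most [2 eps + 2 (2 K S + delta) r <= 2 eps + S / 2 + 2 delta r]
   with [S] the maximum itself. *)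
Lemma gronwall_small (x0 r K delta eps : R) (E dE : bool -> R -> R) :
  0 <= K -> 0 <= delta -> 8 * K * r <= 1 ->
  (forall i x, Rabs (x - x0) < r -> is_derive (E i) x (dE i x)) ->
  (forall i x S, Rabs (x - x0) < r -> (forall j, Rabs (E j x) <= S) ->
     Rabs (dE i x) <= 2 * K * S + delta) ->
  (forall i, Rabs (E i x0) <= eps) ->
  forall i x, Rabs (x - x0) < r -> Rabs (E i x) <= 4 * eps + 4 * delta * r.
Proof.
intros HK Hd HKr HE HdE H0 i x Hx.
set (rho := Rabs (x - x0)) in *.
assert (Hrho : 0 <= rho) by apply Rabs_pos.
assert (Hin : forall y, x0 - rho <= y <= x0 + rho -> Rabs (y - x0) <= rho).
{ intros y Hy. apply Rabs_le. lra. }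
assert (Hcont : forall j y, Rabs (y - x0) < r -> continuity_pt (E j) y).
{ intros j y Hy. apply continuity_pt_filterlim.
  apply (ex_derive_continuous (E j)). exists (dE j y). auto. }
destruct (continuity_ab_maj (fun y => Rabs (E true y) + Rabs (E false y))
   (x0 - rho) (x0 + rho)) as [M [HM HMin]].
- lra.
- intros c Hc. assert (Hc' : Rabs (c - x0) < r) by (generalize (Hin c Hc); lra).
  apply continuity_pt_plus; apply (continuity_pt_comp _ Rabs);
    auto using Rcontinuity_abs.
- set (S := Rabs (E true M) + Rabs (E false M)) in *.
  assert (HS : 0 <= S) by (unfold S; generalize (Rabs_pos (E true M)) (Rabs_pos (E false M)); lra).
  assert (HES : forall j y, x0 - rho <= y <= x0 + rho -> Rabs (E j y) <= S).
  { intros j y Hy. generalize (HM y Hy) (Rabs_pos (E true y)) (Rabs_pos (E false y)).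
    destruct j; lra. }
  assert (HB : forall j, Rabs (E j M) <= eps + (2 * K * S + delta) * r).
  { intros j.
    assert (HV : Rabs (E j M - E j x0) <= (2 * K * S + delta) * Rabs (M - x0)).
    { apply bounded_variation with (dE j). intros t Ht.
      assert (Ht' : Rabs (t - x0) <= rho) by (generalize (Hin M HMin); lra).
      assert (Ht2 : x0 - rho <= t <= x0 + rho) by (apply Rabs_le_between' in Ht'; lra).
      split.
      - apply HE. lra.
      - apply HdE; [lra | auto]. }
    assert ((2 * K * S + delta) * Rabs (M - x0) <= (2 * K * S + delta) * r).
    { apply Rmult_le_compat_l.
      - assert (0 <= K * S) by (apply Rmult_le_pos; lra). lra.
      - generalize (Hin M HMin); lra. }
    generalize (Rabs_triang_inv (E j M) (E j x0)) (H0 j). lra. }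
  assert (HKS : 8 * K * r * S <= 1 * S) by (apply Rmult_le_compat_r; lra).
  assert (HSb : S <= 4 * eps + 4 * delta * r).
  { assert (HSdef : S = Rabs (E true M) + Rabs (E false M)) by reflexivity.
    generalize (HB true) (HB false). clearbody S. lra. }
  apply Rle_trans with S; [|lra].
  apply HES. apply Rabs_le_between'. unfold rho. lra.
Qed.

(** * Uniform convergence of the Picard iterates *)

Lemma geometric_CVU_cauchy (fn : nat -> R -> R) (D : R -> Prop) (C : R) :
  (forall n x, D x -> Rabs (fn (S n) x - fn n x) <= C * (/ 2) ^ n) ->
  CVU_cauchy fn D.
Proof.
intros H.
(* The tail of the geometric series is kept in the bound instead of being dropped; otherwise the
   induction on [k] would not close. *)
assert (Hk : forall n k x, D x ->
  Rabs (fn (n + k)%nat x - fn n x) <= 2 * C * (/ 2) ^ n - 2 * C * (/ 2) ^ (n + k)).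
{ intros n k x Dx. induction k as [|k IH].
  - rewrite Nat.add_0_r. rewrite Rminus_eq_0, Rabs_R0. lra.
  - rewrite Nat.add_succ_r. simpl pow.
    generalize (Rabs_triang (fn (S (n + k)) x - fn (n + k)%nat x)
      (fn (n + k)%nat x - fn n x)) (H (n + k)%nat x Dx).
    replace (fn (S (n + k)) x - fn (n + k)%nat x + (fn (n + k)%nat x - fn n x))
      with (fn (S (n + k)) x - fn n x) by ring. lra. }
intros eps.
assert (Hp : forall k, 0 < (/ 2) ^ k) by (intros k; apply pow_lt; lra).
(* Two terms beyond [N] are each within [2 * Rabs C * (/ 2) ^ N] of term [N], whence the factor 4;
   the [+ 1] keeps the denominator positive. *)
destruct (pow_lt_1_zero (/ 2) ltac:(rewrite Rabs_pos_eq; lra)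
  (eps / (4 * (Rabs C + 1)))) as [N HN].
{ apply Rdiv_lt_0_compat; [apply cond_pos | generalize (Rabs_pos C); lra]. }
assert (HC : 0 < 4 * (Rabs C + 1)) by (generalize (Rabs_pos C); lra).
assert (HCN : 4 * (Rabs C + 1) * (/ 2) ^ N < eps).
{ specialize (HN N (le_n N)). rewrite Rabs_pos_eq in HN by (apply Rlt_le, Hp).
  apply Rmult_lt_compat_l with (1 := HC) in HN.
  replace (4 * (Rabs C + 1) * (eps / (4 * (Rabs C + 1)))) with (pos eps) in HN
    by (field; lra). exact HN. }
exists N.
assert (HNn : forall n x, D x -> (N <= n)%nat ->
  Rabs (fn n x - fn N x) <= 2 * Rabs C * (/ 2) ^ N).
{ intros n x Dx Hn. replace n with (N + (n - N))%nat by lia.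
  generalize (Hk N (n - N)%nat x Dx) (Hp N) (Hp (N + (n - N))%nat) (Rle_abs C).
  generalize (H (N + (n - N))%nat x Dx)
    (Rabs_pos (fn (S (N + (n - N))) x - fn (N + (n - N))%nat x)).
  intros. nra. }
intros n m x Dx Hn Hm.
generalize (HNn n x Dx Hn) (HNn m x Dx Hm).
generalize (Rabs_triang (fn n x - fn N x) (- (fn m x - fn N x))).
rewrite Rabs_Ropp.
replace (fn n x - fn N x + - (fn m x - fn N x)) with (fn n x - fn m x) by ring.
generalize (Hp N) (Rabs_pos C). intros. nra.
Qed.

Lemma CVU_cauchy_is_lim (fn : nat -> R -> R) (D : R -> Prop) (x : R) :
  CVU_cauchy fn D -> D x ->
  is_lim_seq (fun n => fn n x) (real (Lim_seq (fun n => fn n x))).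
Proof.
intros H Dx. apply CVU_dom_cauchy in H.
apply is_lim_seq_spec. intros eps. destruct (H eps) as [N HN].
exists N. intros n Hn. now apply HN.
Qed.

Fixpoint picard (a : bool -> bool -> R -> R) (c : bool -> R) (x0 : R) (n : nat)
    (i : bool) (x : R) : R :=
  match n with
  | O => c i
  | S n => c i + RInt (fun y => mv (fun i j => a i j y) (fun j => picard a c x0 n j y) i) x0 x
  end.

Section Picard.

Variables (a : bool -> bool -> R -> R) (c : bool -> R) (x0 r K : R).
Hypothesis a_cont : forall i j x, continuous (a i j) x.
Hypothesis a_bound : forall i j x, Rabs (a i j x) <= K.
Hypothesis Kr_small : 8 * K * r <= 1.
Hypothesis r_pos : 0 < r.

Let mvp (n : nat) (i : bool) (y : R) : R :=
  mv (fun i j => a i j y) (fun j => picard a c x0 n j y) i.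

(** The two claims feed each other: continuity of an iterate makes the integral defining the next
    one differentiable, hence continuous. *)
Lemma picard_is_derive_cont (n : nat) :
  (forall i x, continuous (picard a c x0 n i) x) /\
  (forall i x, is_derive (picard a c x0 (S n) i) x (mvp n i x)).
Proof.
assert (Hd : forall n, (forall i x, continuous (picard a c x0 n i) x) ->
  forall i x, is_derive (picard a c x0 (S n) i) x (mvp n i x)).
{ intros m Hm i x. rewrite <- (Rplus_0_l (mvp m i x)).
  assert (Hc : forall y, continuous (mvp m i) y).
  { intros y. unfold mvp, mv.
    apply (continuous_plus (V := R_NormedModule));
    apply (continuous_mult (K := R_AbsRing)); auto; apply Hm. }
  apply (is_derive_plus (V := R_NormedModule)).
  - apply is_derive_Reals, derivable_pt_lim_const.
  - apply (is_derive_RInt (mvp m i) _ x0); auto.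
    apply filter_forall. intros y. apply (RInt_correct (V := R_CompleteNormedModule)).

    apply (ex_RInt_continuous (V := R_CompleteNormedModule)). auto. }
induction n as [|n IH].
- assert (Hc0 : forall i x, continuous (picard a c x0 0 i) x)
    by (intros; apply continuous_const).
  split; auto.
- assert (HcS : forall i x, continuous (picard a c x0 (S n) i) x).
  { intros i x. apply (ex_derive_continuous (picard a c x0 (S n) i)).
    exists (mvp n i x). apply IH. }
  split; auto.
Qed.

Lemma picard_init (n : nat) (i : bool) : picard a c x0 n i x0 = c i.
Proof.
destruct n; simpl; auto. rewrite RInt_point. apply Rplus_0_r.
Qed.

Let C : R := Rabs (c true) + Rabs (c false).

(** Bounding the derivative of the difference by [2 * K] times the previous difference contracts by
    [2 * K * r <= 1 / 4] at each step; the ratio [1 / 2] leaves room. *)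
Lemma picard_step (n : nat) (i : bool) (x : R) : Rabs (x - x0) < r ->
  Rabs (picard a c x0 (S n) i x - picard a c x0 n i x) <= C * (/ 2) ^ n.
Proof.
assert (HC : 0 <= C) by (unfold C; generalize (Rabs_pos (c true)) (Rabs_pos (c false)); lra).
assert (HK : 0 <= K) by (generalize (a_bound true true 0) (Rabs_pos (a true true 0)); lra).
revert i x. induction n as [|n IH]; intros i x Hx.
- assert (HV : Rabs (picard a c x0 1 i x - picard a c x0 1 i x0) <= 2 * K * C * Rabs (x - x0)).
  { apply bounded_variation with (mvp 0 i). intros t Ht. split.
    - apply picard_is_derive_cont.
    - apply mv_bound; auto. intros j. simpl. unfold C.
      generalize (Rabs_pos (c true)) (Rabs_pos (c false)). destruct j; lra. }
  rewrite picard_init in HV. change (picard a c x0 0 i x) with (c i).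
  simpl pow. assert (0 <= K * C) by nra.
  assert (K * C * Rabs (x - x0) <= K * C * r) by (apply Rmult_le_compat_l; lra).
  assert (8 * K * r * C <= 1 * C) by (apply Rmult_le_compat_r; lra). lra.
- set (B := C * (/ 2) ^ n).
  assert (HB : 0 <= B) by (apply Rmult_le_pos; auto; apply pow_le; lra).
  set (h := fun y => picard a c x0 (S (S n)) i y - picard a c x0 (S n) i y).
  assert (HV : Rabs (h x - h x0) <= 2 * K * B * Rabs (x - x0)).
  { apply bounded_variation with (fun y => mvp (S n) i y - mvp n i y).
    intros t Ht. split.
    - apply (is_derive_minus (V := R_NormedModule)); apply picard_is_derive_cont.
    - replace (mvp (S n) i t - mvp n i t) with
        (mv (fun i j => a i j t)
           (fun j => picard a c x0 (S n) j t - picard a c x0 n j t) i)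
        by (unfold mvp, mv; ring).
      apply mv_bound; auto. intros j. apply IH. lra. }
  unfold h in HV. rewrite !picard_init in HV.
  replace (c i - c i) with 0 in HV by ring. rewrite Rminus_0_r in HV.
  simpl pow. assert (0 <= K * B) by nra.
  assert (K * B * Rabs (x - x0) <= K * B * r) by (apply Rmult_le_compat_l; lra).
  assert (8 * K * r * B <= 1 * B) by (apply Rmult_le_compat_r; lra).
  unfold B in *. lra.
Qed.

(** The derivatives of the iterates are [a] applied to earlier iterates, so they also converge
    uniformly, and limit and derivative may be exchanged. *)
Lemma picard_limit : exists v : bool -> R -> R,
  (forall i, v i x0 = c i) /\
  forall i x, Rabs (x - x0) < r ->
    is_derive (v i) x (mv (fun i j => a i j x) (fun j => v j x) i).
Proof.
assert (HK : 0 <= K) by (generalize (a_bound true true 0) (Rabs_pos (a true true 0)); lra).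
set (D := fun x => Rabs (x - x0) < r).
assert (Hcv : forall i, CVU_cauchy (fun n => picard a c x0 n i) D).
{ intros i. apply geometric_CVU_cauchy with C. intros n x Dx. now apply picard_step. }
assert (HcvS : forall i, CVU_cauchy (fun n => picard a c x0 (S n) i) D).
{ intros i eps. destruct (Hcv i eps) as [N HN]. exists N.
  intros n m x Dx Hn Hm. apply HN; auto. }
assert (Hcvd : forall i, CVU_cauchy (fun n => mvp n i) D).
{ intros i. apply geometric_CVU_cauchy with (2 * K * C). intros n x Dx.
  replace (mvp (S n) i x - mvp n i x) with
    (mv (fun i j => a i j x)
       (fun j => picard a c x0 (S n) j x - picard a c x0 n j x) i)
    by (unfold mvp, mv; ring).
  rewrite Rmult_assoc. apply mv_bound; auto.
  intros j. now apply picard_step. }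
(* The sequence is shifted by one because only the iterates from the first on have derivative
   [mvp n]. The limit does not see the shift, which closes the equation. *)
exists (fun i x => Lim_seq (fun n => picard a c x0 (S n) i x)). split.
- intros i. rewrite (Lim_seq_ext _ (fun _ => c i)).
  + now rewrite Lim_seq_const.
  + intros n. apply picard_init.
- intros i x Dx.
  assert (HDer : forall n y, Derive (picard a c x0 (S n) i) y = mvp n i y).
  { intros n y. apply is_derive_unique, picard_is_derive_cont. }
  assert (HL : real (Lim_seq (fun n => Derive (picard a c x0 (S n) i) x)) =
    mv (fun i j => a i j x) (fun j => Lim_seq (fun n => picard a c x0 (S n) j x)) i).
  { rewrite (Lim_seq_ext _ (fun n => mvp n i x)) by (intros; apply HDer).
    change (mv _ _ i) with (real (Finite (mv (fun i j => a i j x)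
      (fun j => Lim_seq (fun n => picard a c x0 (S n) j x)) i))).
    f_equal. apply is_lim_seq_unique.
    unfold mvp, mv.
    assert (Hl : forall j, is_lim_seq (fun n => a i j x * picard a c x0 n j x)
      (a i j x * Lim_seq (fun n => picard a c x0 (S n) j x))).
    { intros j. apply (is_lim_seq_scal_l _ (a i j x) (Finite _)).
      rewrite (Lim_seq_incr_1 (fun n => picard a c x0 n j x)).
      now apply (CVU_cauchy_is_lim (fun n => picard a c x0 n j) D). }
    now apply is_lim_seq_plus'. }
  rewrite <- HL.
  apply (CVU_Derive (fun n => picard a c x0 (S n) i) D); auto.
  + intros y Hy.
    apply (open_comp (fun y => Rabs (y - x0)) (fun z => z < r)); auto.
    * intros z _. apply (continuous_comp (fun z => z - x0) Rabs).
      -- apply (continuous_minus (V := R_NormedModule));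
         [apply continuous_id | apply continuous_const].
      -- apply continuous_Rabs.
    * apply open_lt.
  + intros y z w Hy Hz Hw. unfold D in *.
    apply Rabs_lt_between' in Hy. apply Rabs_lt_between' in Hz.
    apply Rabs_lt_between'. lra.
  + now apply CVU_dom_cauchy.
  + intros n y _. exists (mvp n i y). apply picard_is_derive_cont.
  + intros n y _. apply continuity_pt_filterlim.
    apply continuous_ext with (mvp n i). { intros; now rewrite HDer. }
    unfold mvp, mv. apply (continuous_plus (V := R_NormedModule));
    apply (continuous_mult (K := R_AbsRing)); auto; apply picard_is_derive_cont.
  + apply CVU_dom_cauchy. intros eps. destruct (Hcvd i eps) as [N HN].
    exists N. intros n m y Dy Hn Hm. rewrite !HDer. auto.
Qed.

End Picard.

Lemma linear_ode (a : bool -> bool -> R -> R) (c : bool -> R) (x0 r K : R) :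
  0 < r -> 16 * K * r <= 1 ->
  (forall i j x, Rabs (x - x0) < 2 * r -> continuous (a i j) x) ->
  (forall i j x, Rabs (x - x0) < 2 * r -> Rabs (a i j x) <= K) ->
  exists v : bool -> R -> R,
  (forall i, v i x0 = c i) /\
  forall i x, Rabs (x - x0) < r ->
    is_derive (v i) x (mv (fun i j => a i j x) (fun j => v j x) i).
Proof.
intros Hr HKr Hc Hb.
(* The Picard argument works with coefficients continuous and bounded on the whole line. Freezing
   them outside the closed interval of radius [r] provides this; that interval lies inside the
   radius [2 * r] where they are controlled. *)
set (clamp := fun x => Rmax (x0 - r) (Rmin (x0 + r) x)).
assert (Hclamp : forall x, Rabs (clamp x - x0) < 2 * r).
{ intros x. apply Rabs_lt_between'. unfold clamp, Rmax, Rmin.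
  repeat destruct Rle_dec; lra. }
assert (HK : 0 <= K).
{ generalize (Hb true true _ (Hclamp 0)) (Rabs_pos (a true true (clamp 0))). lra. }
assert (Hcc : forall x, continuous clamp x).
{ intros x. apply continuity_pt_filterlim.
  (* Minimum and maximum are expressed by absolute values: half of the sum of the two numbers, minus
     or plus half of the distance between them. *)
  apply (continuity_pt_ext (fun y => ((x0 - r) + ((x0 + r + y - Rabs (x0 + r - y)) / 2)
    + Rabs ((x0 - r) - ((x0 + r + y - Rabs (x0 + r - y)) / 2))) / 2)).
  - intros y. unfold clamp, Rmax, Rmin, Rabs.
    repeat destruct Rle_dec; repeat destruct Rcase_abs; lra.
  - assert (HA : continuity_pt (fun y => (x0 + r + y - Rabs (x0 + r - y)) / 2) x).
    { apply (continuity_pt_mult _ (fun _ => / 2)).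
      + apply continuity_pt_minus.
        * apply continuity_pt_plus; [apply continuity_pt_const; now intros ? ? |
            apply continuity_pt_id].
        * apply (continuity_pt_comp _ Rabs); [|apply Rcontinuity_abs].
          apply continuity_pt_minus; [apply continuity_pt_const; now intros ? ? |
            apply continuity_pt_id].
      + apply continuity_pt_const; now intros ? ?. }
    apply (continuity_pt_mult _ (fun _ => / 2)).
    + apply continuity_pt_plus.
      * apply continuity_pt_plus; auto. apply continuity_pt_const; now intros ? ?.
      * apply (continuity_pt_comp _ Rabs); [|apply Rcontinuity_abs].
        apply continuity_pt_minus; auto. apply continuity_pt_const; now intros ? ?.
    + apply continuity_pt_const; now intros ? ?. }
destruct (picard_limit (fun i j x => a i j (clamp x)) c x0 r K) as [v [Hv0 Hv]]; auto.
- intros i j x. apply (continuous_comp clamp (a i j)); auto.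
- lra.
- exists v. split; auto. intros i x Hx.
  replace (mv (fun i j => a i j x) (fun j => v j x) i) with
    (mv (fun i j => a i j (clamp x)) (fun j => v j x) i).
  + auto.
  + apply Rabs_lt_between' in Hx.
    assert (E : clamp x = x).
    { unfold clamp. rewrite Rmin_right by lra. apply Rmax_right. lra. }
    now rewrite E.
Qed.

(** * Parallel sections of flat connections *)

Definition mx (a b : bool -> bool -> R) (i j : bool) : R := mv a (fun k => b k j) i.

Lemma ball_box (t0 x0 t x r : R) :
  ball ((t0, x0) : R * R) r (t, x) <-> Rabs (t - t0) < r /\ Rabs (x - x0) < r.
Proof. reflexivity. Qed.

Lemma open_ball_box (p : R * R) (r : R) : open (ball p r).
Proof.
destruct p as [t0 x0]. intros [t x] [Ht Hx].
change (Rabs (t - t0) < r) in Ht. change (Rabs (x - x0) < r) in Hx.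
assert (Hd : 0 < Rmin (r - Rabs (t - t0)) (r - Rabs (x - x0))) by (apply Rmin_pos; lra).
exists (mkposreal _ Hd). intros [s y] [Hs Hy].
change (Rabs (s - t) < Rmin (r - Rabs (t - t0)) (r - Rabs (x - x0))) in Hs.
change (Rabs (y - x) < Rmin (r - Rabs (t - t0)) (r - Rabs (x - x0))) in Hy.
apply ball_box.
generalize (Rmin_l (r - Rabs (t - t0)) (r - Rabs (x - x0)))
  (Rmin_r (r - Rabs (t - t0)) (r - Rabs (x - x0))).
generalize (Rabs_triang (s - t) (t - t0)) (Rabs_triang (y - x) (x - x0)).
replace (s - t + (t - t0)) with (s - t0) by ring.
replace (y - x + (x - x0)) with (y - x0) by ring. lra.
Qed.

(** Two applications of the mean value inequality, first to [df], then to the remainder; the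
    constant is [K] instead of the sharp [K / 2]. *)
Lemma taylor1_bound (f df ddf : R -> R) (t h K : R) : 0 <= K ->
  (forall s, Rabs (s - t) <= Rabs h ->
     is_derive f s (df s) /\ is_derive df s (ddf s) /\ Rabs (ddf s) <= K) ->
  Rabs (f (t + h) - f t - h * df t) <= K * (Rabs h * Rabs h).
Proof.
intros HK H.
assert (Hdf : forall s, Rabs (s - t) <= Rabs h -> Rabs (df s - df t) <= K * Rabs (s - t)).
{ intros s Hs. apply bounded_variation with ddf.
  intros u Hu. destruct (H u) as [_ [H2 H3]]; [lra | now split]. }
assert (Hh : t + h - t = h) by ring.
set (g := fun s => f s - f t - (s - t) * df t).
assert (Hg : Rabs (g (t + h) - g t) <= K * Rabs h * Rabs (t + h - t)).
{ apply bounded_variation with (fun s => df s - df t).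
  rewrite Hh. intros s Hs. split.
  - unfold g. destruct (H s Hs) as [H1 _].
    auto_derive.
    + now exists (df s).
    + replace (Derive (fun x => f x) s) with (df s)
        by (symmetry; now apply is_derive_unique). ring.
  - apply Rle_trans with (1 := Hdf s Hs). apply Rmult_le_compat_l; auto. }
unfold g in Hg. rewrite Hh in Hg.
replace (f (t + h) - f t - h * df t) with
  (f (t + h) - f t - h * df t - (f t - f t - (t - t) * df t)) by ring.
lra.
Qed.

Lemma bounded_near (f : bool -> bool -> R -> R -> R) (t0 x0 : R) :
  (forall i j, continuity_2d_pt (f i j) t0 x0) ->
  exists K, 0 <= K /\ locally_2d (fun t x => forall i j, Rabs (f i j t x) <= K) t0 x0.
Proof.
intros H.
set (K := Rabs (f true true t0 x0) + Rabs (f true false t0 x0)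
        + Rabs (f false true t0 x0) + Rabs (f false false t0 x0) + 1).
assert (HK : forall i j, Rabs (f i j t0 x0) + 1 <= K).
{ generalize (Rabs_pos (f true true t0 x0)) (Rabs_pos (f true false t0 x0))
    (Rabs_pos (f false true t0 x0)) (Rabs_pos (f false false t0 x0)).
  intros; unfold K; destruct i, j; lra. }
assert (HL : forall i j, locally_2d (fun t x => Rabs (f i j t x) <= K) t0 x0).
{ intros i j. apply locally_2d_impl with (2 := H i j (mkposreal 1 Rlt_0_1)).
  apply locally_2d_forall. intros t x Htx. simpl in Htx.
  generalize (Rabs_triang_inv (f i j t x) (f i j t0 x0)) (HK i j). lra. }
exists K. split.
- generalize (HK true true) (Rabs_pos (f true true t0 x0)). lra.
- apply locally_2d_impl with
    (2 := locally_2d_and _ _ _ _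
       (locally_2d_and _ _ _ _ (HL true true) (HL true false))
       (locally_2d_and _ _ _ _ (HL false true) (HL false false))).
  apply locally_2d_forall. intros t x [[] []] [] []; assumption.
Qed.

(** Differentiability in each variable separately does not give joint continuity. Here one moves in
    [t] along a single horizontal line, then in [x] with a Lipschitz constant uniform in [s]. *)
Lemma continuity_2d_bounded_derive_x (f fx : R -> R -> R) (t x r K : R) :
  0 < r -> 0 <= K ->
  continuous (fun s => f s x) t ->
  (forall s y, Rabs (s - t) < r -> Rabs (y - x) < r ->
     is_derive (fun z => f s z) y (fx s y) /\ Rabs (fx s y) <= K) ->
  continuity_2d_pt f t x.
Proof.
intros Hr HK Hc H eps.
assert (He : 0 < eps / 2) by (generalize (cond_pos eps); lra).
apply continuity_pt_filterlim in Hc.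
destruct (proj1 (filterlim_locally (fun s => f s x) _) (proj1 (continuity_pt_filterlim _ _) Hc)
  (mkposreal _ He)) as [d Hd].
assert (HKe : 0 < eps / 2 / (K + 1)) by (apply Rdiv_lt_0_compat; lra).
assert (Hdel : 0 < Rmin (Rmin r d) (eps / 2 / (K + 1)))
  by (repeat apply Rmin_pos; auto; apply cond_pos).
exists (mkposreal _ Hdel). simpl. intros s y Hs Hy.
generalize (Rmin_l (Rmin r d) (eps / 2 / (K + 1))) (Rmin_r (Rmin r d) (eps / 2 / (K + 1)))
  (Rmin_l r d) (Rmin_r r d). intros M1 M2 M3 M4.
assert (H1 : Rabs (f s x - f t x) < eps / 2).
{ apply (Hd s). change (Rabs (s - t) < d). lra. }
assert (H2 : Rabs (f s y - f s x) <= K * Rabs (y - x)).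
{ apply bounded_variation with (fx s). intros z Hz. apply H; lra. }
assert (H3 : K * Rabs (y - x) <= K * (eps / 2 / (K + 1))) by (apply Rmult_le_compat_l; lra).
assert (H4 : (K + 1) * (eps / 2 / (K + 1)) = eps / 2) by (field; lra).
generalize (Rabs_triang (f s y - f s x) (f s x - f t x)).
replace (f s y - f s x + (f s x - f t x)) with (f s y - f t x) by ring. lra.
Qed.

(** Bootstrapping: both derivatives of [v] are linear in [v] with smooth coefficients, so each order
    of smoothness of [v] yields the next, starting from continuity. *)
Lemma smoothN_parallel (U : R * R -> Prop) (m n : bool -> bool -> R -> R -> R)
    (v : bool -> R -> R -> R) : open U ->
  (forall i j, smooth2 U (m i j)) -> (forall i j, smooth2 U (n i j)) ->
  (forall i t x, U (t, x) -> continuity_2d_pt (v i) t x) ->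
  (forall i t x, U (t, x) -> is_derive (fun s => v i s x) t
     (mv (fun i j => n i j t x) (fun j => v j t x) i)) ->
  (forall i t x, U (t, x) -> is_derive (fun y => v i t y) x
     (mv (fun i j => m i j t x) (fun j => v j t x) i)) ->
  forall i, smooth2 U (v i).
Proof.
intros HU Hm Hn Hc Ht Hx i. apply smooth2_smoothN. intros k. revert i.
induction k as [|k IH]; intros i.
- intros t x Utx. split; auto.
- apply smoothN_S with
    (fun t x => mv (fun i j => n i j t x) (fun j => v j t x) i)
    (fun t x => mv (fun i j => m i j t x) (fun j => v j t x) i); auto;
  unfold mv; apply smoothN_plus; auto; apply smoothN_mult; auto;
  now apply smooth2_smoothN.
Qed.

(** Zero curvature: equality of the two mixed derivatives of [v] when [v_x = m v] and [v_t = n v],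
    for arbitrary values of [v]. *)
Definition flat (D : R * R -> Prop) (m n : bool -> bool -> R -> R -> R) : Prop :=
  forall i j t x, D (t, x) ->
    d_t (m i j) t x + mx (fun i j => m i j t x) (fun i j => n i j t x) i j =
    d_x (n i j) t x + mx (fun i j => n i j t x) (fun i j => m i j t x) i j.

(** * Differentiability in [t] of sections integrated along [x] *)

Section TDerivative.

Variables (t0 x0 r K S : R) (m n : bool -> bool -> R -> R -> R) (v : bool -> R -> R -> R).
Let U (t x : R) : Prop := Rabs (t - t0) < r /\ Rabs (x - x0) < r.
Hypothesis K_pos : 0 <= K.
Hypothesis S_pos : 0 <= S.
Hypothesis Kr_small : 8 * K * r <= 1.
Hypothesis m_deriv : forall i j t x, U t x ->
  is_derive (fun s => m i j s x) t (d_t (m i j) t x) /\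
  is_derive (fun s => d_t (m i j) s x) t (d_t (d_t (m i j)) t x).
Hypothesis n_deriv : forall i j t x, U t x ->
  is_derive (fun y => n i j t y) x (d_x (n i j) t x).
Hypothesis m_bound : forall i j t x, U t x ->
  Rabs (m i j t x) <= K /\ Rabs (n i j t x) <= K /\
  Rabs (d_t (m i j) t x) <= K /\ Rabs (d_t (d_t (m i j)) t x) <= K.
Hypothesis mn_flat : flat (fun p => U (fst p) (snd p)) m n.
Hypothesis v_x : forall i t x, U t x -> is_derive (fun y => v i t y) x
     (mv (fun i j => m i j t x) (fun j => v j t x) i).
Hypothesis v_t0 : forall i t, Rabs (t - t0) < r -> is_derive (fun s => v i s x0) t
     (mv (fun i j => n i j t x0) (fun j => v j t x0) i).
Hypothesis v_bound : forall i t x, U t x -> Rabs (v i t x) <= S.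

(* [E = v(t+h) - v(t) - h n v(t)] satisfies [E_x = m(t+h) E + O(h^2)] because
   of the flatness, and is [o(h)] at [x0]. *)
Lemma parallel_t_derive (i : bool) (t x : R) : U t x ->
  is_derive (fun s => v i s x) t (mv (fun i j => n i j t x) (fun j => v j t x) i).
Proof.
intros HU. assert (HU' := HU). destruct HU as [Ht Hx].
assert (Hr : 0 < r) by (generalize (Rabs_pos (t - t0)); lra).
assert (Hx0 : Rabs (x0 - x0) < r) by (rewrite Rminus_eq_0, Rabs_R0; lra).
apply is_derive_Reals. intros eps Heps.
assert (Heps8 : 0 < eps / 8) by lra.
assert (Hw : exists d : posreal, forall j h, h <> 0 -> Rabs h < d ->
  Rabs (v j (t + h) x0 - v j t x0
    - h * mv (fun i j => n i j t x0) (fun j => v j t x0) j) <= eps / 8 * Rabs h).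
{ assert (Hw1 : forall j, exists d : posreal, forall h, h <> 0 -> Rabs h < d ->
  Rabs (v j (t + h) x0 - v j t x0
    - h * mv (fun i j => n i j t x0) (fun j => v j t x0) j) <= eps / 8 * Rabs h).
  { intros j. generalize (v_t0 j t Ht). intros Hd. apply is_derive_Reals in Hd.
    destruct (Hd (eps / 8) Heps8) as [d Hdd]. exists d. intros h Hh Hhd.
    specialize (Hdd h Hh Hhd). set (l := mv _ _ _) in *.
    replace (v j (t + h) x0 - v j t x0 - h * l)
      with (((v j (t + h) x0 - v j t x0) / h - l) * h) by (field; auto).
    rewrite Rabs_mult. apply Rmult_le_compat_r; [apply Rabs_pos | lra]. }
  destruct (Hw1 true) as [d1 Hd1]. destruct (Hw1 false) as [d2 Hd2].
  exists (mkposreal _ (Rmin_pos _ _ (cond_pos d1) (cond_pos d2))). simpl.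
  intros j h Hh Hhd. generalize (Rmin_l d1 d2) (Rmin_r d1 d2). intros M1 M2.
  destruct j; [apply Hd1 | apply Hd2]; auto; lra. }
destruct Hw as [d Hd].
(* Coefficient of the quadratic error in [h]: the first summand comes from the Taylor remainder of
   [m] applied to [v], the second from [h] times the increment of [m] applied to [n v]. *)
set (T := 2 * K * S + 2 * K * (2 * K * S)).
assert (HT : 0 <= T).
{ unfold T. assert (0 <= K * S) by (apply Rmult_le_pos; auto).
  assert (0 <= K * (K * S)) by (apply Rmult_le_pos; auto). lra. }
assert (HTr : 0 < 8 * T * r + 1).
{ assert (0 <= T * r) by (apply Rmult_le_pos; lra). lra. }
(* Gronwall will give [4 * (eps / 8) * Rabs h + 4 * T * r * (Rabs h * Rabs h)]. The last bound on
   [h] makes the second term less than [eps / 2 * Rabs h]; the other two keep the initial estimate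
   valid and [t + h] in the box. *)
assert (Hdel : 0 < Rmin (Rmin d (r - Rabs (t - t0))) (eps / (8 * T * r + 1))).
{ repeat apply Rmin_pos; [apply cond_pos | lra | apply Rdiv_lt_0_compat; lra]. }
exists (mkposreal _ Hdel). simpl. intros h Hh Hhd.
generalize (Rmin_l (Rmin d (r - Rabs (t - t0))) (eps / (8 * T * r + 1)))
  (Rmin_r (Rmin d (r - Rabs (t - t0))) (eps / (8 * T * r + 1)))
  (Rmin_l d (r - Rabs (t - t0))) (Rmin_r d (r - Rabs (t - t0))). intros M1 M2 M3 M4.
assert (Hnear : forall s, Rabs (s - t) <= Rabs h -> Rabs (s - t0) < r).
{ intros s Hs. generalize (Rabs_triang (s - t) (t - t0)).
  replace (s - t + (t - t0)) with (s - t0) by ring. lra. }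
assert (Hth : Rabs (t + h - t0) < r).
{ apply Hnear. replace (t + h - t) with h by ring. lra. }
set (E := fun j y => v j (t + h) y - v j t y
    - h * mv (fun i j => n i j t y) (fun j => v j t y) j).
set (dE := fun j y =>
  mv (fun i j => m i j (t + h) y) (fun j => v j (t + h) y) j
  - mv (fun i j => m i j t y) (fun j => v j t y) j
  - h * (mv (fun i j => d_x (n i j) t y) (fun j => v j t y) j
         + mv (fun i j => n i j t y)
             (mv (fun i j => m i j t y) (fun j => v j t y)) j)).
assert (HE : forall j y, Rabs (y - x0) < r ->
  Rabs (E j y) <= 4 * (eps / 8 * Rabs h) + 4 * (T * (Rabs h * Rabs h)) * r).
{ apply gronwall_small with K dE; auto.
  - apply Rmult_le_pos; auto. apply Rmult_le_pos; apply Rabs_pos.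
  - intros j y Hy.
    apply (is_derive_minus (V := R_NormedModule)
      (fun y => v j (t + h) y - v j t y)
      (fun y => h * mv (fun i j => n i j t y) (fun j => v j t y) j)).
    + apply (is_derive_minus (V := R_NormedModule)); apply v_x; now split.
    + apply (is_derive_scal (fun y => mv (fun i j => n i j t y) (fun j => v j t y) j)).
      assert (HP : forall k, is_derive (fun y => n j k t y * v k t y) y
        (d_x (n j k) t y * v k t y
         + n j k t y * mv (fun i j => m i j t y) (fun j => v j t y) k)).
      { intros k. apply (is_derive_mult (fun y => n j k t y) (fun y => v k t y)).
        - apply n_deriv; now split.
        - apply v_x; now split.
        - intros; apply Rmult_comm. }
      generalize (is_derive_plus (V := R_NormedModule) _ _ _ _ _ (HP true) (HP false)).
      intros HPP. unfold mv at 1.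
      match goal with |- is_derive _ _ ?l => match type of HPP with
        is_derive _ _ ?l' => replace l with l' end end.
      * exact HPP.
      * unfold mv, plus; simpl. ring.
  - intros j y B Hy HB.
    assert (HUt : U t y) by now split.
    assert (HUth : U (t + h) y) by now split.
    assert (Hlip : forall i j, Rabs (m i j (t + h) y - m i j t y) <= K * Rabs h).
    { intros k l. replace (Rabs h) with (Rabs (t + h - t)) by (f_equal; ring).
      apply (bounded_variation (fun s => m k l s y) (fun s => d_t (m k l) s y)).
      replace (t + h - t) with h by ring. intros s Hs.
      assert (HUs : U s y) by (split; auto). split; [now apply m_deriv | now apply m_bound]. }
    assert (Htay : forall i j,
      Rabs (m i j (t + h) y - m i j t y - h * d_t (m i j) t y) <= K * (Rabs h * Rabs h)).
    { intros k l. apply (taylor1_bound (fun s => m k l s y) (fun s => d_t (m k l) s y)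
        (fun s => d_t (d_t (m k l)) s y)); auto.
      intros s Hs. assert (HUs : U s y) by (split; auto).
      split; [now apply m_deriv | split; [now apply m_deriv | now apply m_bound]]. }
    assert (HdE : dE j y =
      mv (fun i j => m i j (t + h) y) (fun j => E j y) j
      + (mv (fun i j => m i j (t + h) y - m i j t y - h * d_t (m i j) t y)
           (fun j => v j t y) j
         + h * mv (fun i j => m i j (t + h) y - m i j t y)
             (mv (fun i j => n i j t y) (fun j => v j t y)) j)).
    (* Flatness trades [d_x n] for [d_t m] plus the commutator of [m] and [n]. The decomposition is
       then an algebraic identity. *)
    { assert (F : forall k, d_x (n j k) t y = d_t (m j k) t y
        + mx (fun i j => m i j t y) (fun i j => n i j t y) j k
        - mx (fun i j => n i j t y) (fun i j => m i j t y) j k).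
      { intros k. rewrite (mn_flat j k t y HUt). ring. }
      unfold dE, E. unfold mv at 3. rewrite (F true), (F false).
      unfold mx, mv. ring. }
    rewrite HdE.
    assert (B1 := mv_bound (fun i j => m i j (t + h) y) (fun j => E j y) K B j
      (fun i j => proj1 (m_bound i j _ _ HUth)) HB).
    assert (B2 := mv_bound _ (fun j => v j t y) _ S j Htay (fun j => v_bound j t y HUt)).
    assert (B3 := mv_bound _ (mv (fun i j => n i j t y) (fun j => v j t y)) _
      (2 * K * S) j Hlip
      (fun k => mv_bound _ _ K S k (fun i j => proj1 (proj2 (m_bound i j _ _ HUt)))
         (fun j => v_bound j t y HUt))).
    apply Rle_trans with (1 := Rabs_triang _ _). apply Rplus_le_compat; auto.
    apply Rle_trans with (1 := Rabs_triang _ _). rewrite (Rabs_mult h).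
    apply Rmult_le_compat_l with (1 := Rabs_pos h) in B3. unfold T. lra.
  - intros j. apply Hd; auto. lra. }
specialize (HE i x Hx). unfold E in HE.
set (l := mv _ _ _) in *.
replace ((v i (t + h) x - v i t x) / h - l)
  with ((v i (t + h) x - v i t x - h * l) / h) by (field; auto).
unfold Rdiv. rewrite Rabs_mult, Rabs_inv.
assert (Hhp : 0 < Rabs h) by now apply Rabs_pos_lt.
apply Rmult_lt_reg_r with (1 := Hhp). rewrite Rmult_assoc, Rinv_l, Rmult_1_r by lra.
apply Rle_lt_trans with (1 := HE).
assert (HL : Rabs h * (8 * T * r + 1) < eps).
{ apply Rlt_le_trans with (eps / (8 * T * r + 1) * (8 * T * r + 1)).
  - apply Rmult_lt_compat_r; lra.
  - right. field. lra. }
apply Rmult_lt_compat_r with (1 := Hhp) in HL. nra.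
Qed.

End TDerivative.

(** The radius is chosen before the initial vector [c]: for a linear system it depends only on
    bounds for the coefficients. Two sections with different initial values thus live on the same
    ball. *)
Lemma frobenius (D : R * R -> Prop) (m n : bool -> bool -> R -> R -> R)
    (t0 x0 : R) : open D -> D (t0, x0) ->
  (forall i j, smooth2 D (m i j)) -> (forall i j, smooth2 D (n i j)) ->
  flat D m n ->
  exists r : posreal, (forall p, ball ((t0, x0) : R * R) r p -> D p) /\
  forall c : bool -> R, exists v : bool -> R -> R -> R,
    (forall i, v i t0 x0 = c i) /\
    (forall i, smooth2 (ball ((t0, x0) : R * R) r) (v i)) /\
    forall i t x, ball ((t0, x0) : R * R) r (t, x) ->
      is_derive (fun s => v i s x) t (mv (fun i j => n i j t x) (fun j => v j t x) i) /\
      is_derive (fun y => v i t y) x (mv (fun i j => m i j t x) (fun j => v j t x) i).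
Proof.
intros HD D0 Hm Hn Hflat.
assert (Hm' : forall k i j, smoothN k D (m i j)) by (intros; now apply smooth2_smoothN).
assert (Hn' : forall k i j, smoothN k D (n i j)) by (intros; now apply smooth2_smoothN).
destruct (bounded_near m t0 x0) as [K1 [HK1 L1]].
{ intros i j. now apply (smoothN_cont 0 D). }
destruct (bounded_near n t0 x0) as [K2 [HK2 L2]].
{ intros i j. now apply (smoothN_cont 0 D). }
destruct (bounded_near (fun i j => d_t (m i j)) t0 x0) as [K3 [HK3 L3]].
{ intros i j. apply (smoothN_cont 0 D); auto. now apply smoothN_d_t. }
destruct (bounded_near (fun i j => d_t (d_t (m i j))) t0 x0) as [K4 [HK4 L4]].
{ intros i j. apply (smoothN_cont 0 D); auto. now apply smoothN_d_t, smoothN_d_t. }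
destruct (locally_2d_and _ _ _ _ (open_locally_2d D t0 x0 HD D0)
  (locally_2d_and _ _ _ _ (locally_2d_and _ _ _ _ L1 L2) (locally_2d_and _ _ _ _ L3 L4)))
  as [d Hd].
(* One bound for [m], [n] and two [t]-derivatives of [m], made positive by the [+ 1]. The radius
   below keeps the double box inside the region of these bounds and makes [16 * K * r] at most 1, as
   [linear_ode] requires. *)
set (K := K1 + K2 + K3 + K4 + 1).
assert (HK : 0 < K) by (unfold K; lra).
assert (Hr : 0 < Rmin (d / 2) (/ (16 * K))).
{ apply Rmin_pos; [generalize (cond_pos d); lra | apply Rinv_0_lt_compat; lra]. }
exists (mkposreal _ Hr). simpl. set (r := Rmin _ _) in *.
assert (Hrd : 2 * r <= d) by (generalize (Rmin_l (d / 2) (/ (16 * K))); fold r; lra).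
assert (HKr : 16 * K * r <= 1).
{ generalize (Rmin_r (d / 2) (/ (16 * K))); fold r. intros Hle.
  apply Rmult_le_compat_l with (r := 16 * K) in Hle; [|lra].
  rewrite Rinv_r in Hle by lra. lra. }
assert (Hbox : forall t x, Rabs (t - t0) < 2 * r -> Rabs (x - x0) < 2 * r ->
  D (t, x) /\ forall i j, Rabs (m i j t x) <= K /\ Rabs (n i j t x) <= K /\
    Rabs (d_t (m i j) t x) <= K /\ Rabs (d_t (d_t (m i j)) t x) <= K).
{ intros t x Ht Hx. destruct (Hd t x) as [H0 [[H1 H2] [H3 H4]]]; try lra.
  split; auto. intros i j. unfold K.
  generalize (H1 i j) (H2 i j) (H3 i j) (H4 i j). repeat split; lra. }
assert (Ht0 : Rabs (t0 - t0) < r) by (rewrite Rminus_eq_0, Rabs_R0; lra).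
assert (Hx0 : Rabs (x0 - x0) < r) by (rewrite Rminus_eq_0, Rabs_R0; lra).
split.
{ intros [t x] Htx. destruct (proj1 (ball_box _ _ _ _ _) Htx) as [Ht Hx]. apply Hbox; lra. }
intros c.
destruct (linear_ode (fun i j s => n i j s x0) c t0 r K) as [w [Hw0 Hw]]; auto.
{ intros i j t Ht. apply (ex_derive_continuous (fun s => n i j s x0)).
  eexists. apply (smoothN_is_derive_t 0 D); auto. apply Hbox; lra. }
{ intros i j t Ht. apply Hbox; lra. }
(* For each [t] a solution in [x] starting from [w] at [x0] is selected; nothing ties the selections
   for different [t] together except their values at [x0]. *)
destruct (functional_choice (A := R) (B := bool -> R -> R)
  (fun t u => Rabs (t - t0) < r -> (forall i, u i x0 = w i t) /\
  forall i x, Rabs (x - x0) < r ->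
    is_derive (u i) x (mv (fun i j => m i j t x) (fun j => u j x) i))) as [V HV].
{ intros t. destruct (Rlt_dec (Rabs (t - t0)) r) as [Ht|Ht].
  - destruct (linear_ode (fun i j y => m i j t y) (fun i => w i t) x0 r K)
      as [u [Hu0 Hu]]; auto.
    + intros i j x Hx. apply (ex_derive_continuous (fun y => m i j t y)).
      eexists. apply (smoothN_is_derive_x 0 D); auto. apply Hbox; lra.
    + intros i j x Hx. apply Hbox; lra.
    + exists u. intros _. now split.
  (* Outside the time interval the requirement is vacuous and zero is a default. *)
  - exists (fun _ _ => 0). now intros. }
set (v := fun i t x => V t i x).
assert (Hvx : forall i t x, Rabs (t - t0) < r /\ Rabs (x - x0) < r ->
  is_derive (fun y => v i t y) x (mv (fun i j => m i j t x) (fun j => v j t x) i)).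
{ intros i t x [Ht Hx]. now apply HV. }
assert (Hvt0 : forall i t, Rabs (t - t0) < r ->
  is_derive (fun s => v i s x0) t (mv (fun i j => n i j t x0) (fun j => v j t x0) i)).
{ intros i t Ht. apply is_derive_ext_loc with (w i).
  - exists (mkposreal _ (proj2 (Rlt_0_minus _ _) Ht)). intros s Hs.
    change (Rabs (s - t) < r - Rabs (t - t0)) in Hs. symmetry. apply HV.
    generalize (Rabs_triang (s - t) (t - t0)).
    replace (s - t + (t - t0)) with (s - t0) by ring. lra.
  - unfold v, mv. rewrite !(proj1 (HV t Ht)). now apply Hw. }
(* Gronwall with [delta = 0] multiplies the size of the initial data by at most 4, once along
   [x = x0] and once more in the [x] direction, whence the later bound [4 * W]. *)
set (W := 4 * (Rabs (c true) + Rabs (c false))).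
assert (HW : 0 <= W).
{ unfold W. generalize (Rabs_pos (c true)) (Rabs_pos (c false)). lra. }
assert (Hwb : forall i t, Rabs (t - t0) < r -> Rabs (w i t) <= W).
{ intros i t Ht.
  replace W with (4 * (Rabs (c true) + Rabs (c false)) + 4 * 0 * r) by (unfold W; ring).
  apply (gronwall_small t0 r K 0 _ w
    (fun i t => mv (fun i j => n i j t x0) (fun j => w j t) i)); auto; try lra.
  - intros j s S Hs HS. rewrite Rplus_0_r. apply mv_bound; auto.
    intros; apply Hbox; lra.
  - intros j. rewrite Hw0. generalize (Rabs_pos (c true)) (Rabs_pos (c false)).
    destruct j; lra. }
assert (Hvb : forall i t x, Rabs (t - t0) < r /\ Rabs (x - x0) < r ->
  Rabs (v i t x) <= 4 * W).
{ intros i t x [Ht Hx]. replace (4 * W) with (4 * W + 4 * 0 * r) by ring.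
  apply (gronwall_small x0 r K 0 W (fun i x => v i t x)
    (fun i x => mv (fun i j => m i j t x) (fun j => v j t x) i)); auto; try lra.
  - intros j y S Hy HS. rewrite Rplus_0_r. apply mv_bound; auto.
    intros; apply Hbox; lra.
  - intros j. unfold v. rewrite (proj1 (HV t Ht)). auto. }
assert (Hvt : forall i t x, Rabs (t - t0) < r /\ Rabs (x - x0) < r ->
  is_derive (fun s => v i s x) t (mv (fun i j => n i j t x) (fun j => v j t x) i)).
{ intros i t x Htx. apply (parallel_t_derive t0 x0 r K (4 * W) m n v); auto; try lra.
  - intros j k s y [Hs Hy]. assert (Dsy : D (s, y)) by (apply Hbox; lra).
    split; apply (smoothN_is_derive_t 0 D); auto. now apply smoothN_d_t.
  - intros j k s y [Hs Hy]. apply (smoothN_is_derive_x 0 D); auto. apply Hbox; lra.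
  - intros j k s y [Hs Hy]. apply Hbox; lra.
  - intros j k s y [Hs Hy]. apply Hflat. apply Hbox; simpl in *; lra. }
exists v. split; [|split].
- intros i. unfold v. now rewrite (proj1 (HV t0 Ht0)).
- assert (HU : forall p, ball ((t0, x0) : R * R) r p -> D p).
  { intros [t x] Htx. destruct (proj1 (ball_box _ _ _ _ _) Htx) as [Ht Hx]. apply Hbox; lra. }
  apply smoothN_parallel with m n; auto using open_ball_box.
  + intros i j k t x Htx. now apply Hm, HU.
  + intros i j k t x Htx. now apply Hn, HU.
  + intros i t x Htx. assert (Htx' := Htx). apply (proj1 (ball_box _ _ _ _ _)) in Htx.
    destruct (open_ball_box (t0, x0) r (t, x) Htx') as [e He].
    (* The Lipschitz constant in [x] is [mv_bound] applied to the system, with entries at most [K]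
       and [v] at most [4 * W]. *)
    apply (continuity_2d_bounded_derive_x (v i)
      (fun t x => mv (fun i j => m i j t x) (fun j => v j t x) i) t x e (2 * K * (4 * W))).
    * apply cond_pos.
    * apply Rmult_le_pos; lra.
    * apply (ex_derive_continuous (fun s => v i s x)). eexists. now apply Hvt.
    * intros s y Hs Hy. assert (Hsy : ball ((t0, x0) : R * R) r (s, y)) by (apply He; now split).
      apply (proj1 (ball_box _ _ _ _ _)) in Hsy. split; [now apply Hvx|].
      apply mv_bound; auto. intros j k. apply Hbox; lra.
- intros i t x Htx. apply (proj1 (ball_box _ _ _ _ _)) in Htx.
  split; [now apply Hvt | now apply Hvx].
Qed.

(** * Jets and the reduction condition *)

Definition over (Om : R * R * R -> Prop) (j : jet) : Prop := Om (j Jt, j Jx, j Ju).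

(** Since [pd] is a one-variable derivative, the sum and product rules for [Dt] and [Dx] need
    differentiability along each coordinate line only. *)
Definition differentiable_coord (F : jet -> R) (j : jet) : Prop :=
  forall c : jvar, ex_derive (fun s => F (upd j c s)) (j c).

Lemma upd_id (j : jet) (c : jvar) : upd j c (j c) = j.
Proof. apply functional_extensionality. intros c'. now destruct c, c'. Qed.

Lemma over_upd (Om : R * R * R -> Prop) (j : jet) (c : jvar) :
  open Om -> over Om j -> locally (j c) (fun s => over Om (upd j c s)).
Proof.
intros HO Hj. destruct (HO _ Hj) as [e He].
destruct c; try (now apply filter_forall);
  exists e; intros s Hs; apply He; repeat split; auto using ball_center.
Qed.

Lemma pd_ext (Om : R * R * R -> Prop) (F G : jet -> R) (j : jet) (c : jvar) :
  open Om -> (forall j, over Om j -> F j = G j) -> over Om j ->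
  pd c F j = pd c G j.
Proof.
intros HO HFG Hj. apply Derive_ext_loc.
generalize (over_upd Om j c HO Hj). apply filter_imp. auto.
Qed.

Lemma differentiable_coord_ext (Om : R * R * R -> Prop) (F G : jet -> R) (j : jet) :
  open Om -> (forall j, over Om j -> F j = G j) -> over Om j ->
  differentiable_coord F j -> differentiable_coord G j.
Proof.
intros HO HFG Hj HF c. apply ex_derive_ext_loc with (2 := HF c).
generalize (over_upd Om j c HO Hj). apply filter_imp. auto.
Qed.

Lemma pd_plus (F G : jet -> R) (j : jet) (c : jvar) :
  differentiable_coord F j -> differentiable_coord G j ->
  pd c (fun j => F j + G j) j = pd c F j + pd c G j.
Proof. intros HF HG. apply Derive_plus; auto. Qed.

Lemma pd_minus (F G : jet -> R) (j : jet) (c : jvar) :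
  differentiable_coord F j -> differentiable_coord G j ->
  pd c (fun j => F j - G j) j = pd c F j - pd c G j.
Proof. intros HF HG. apply Derive_minus; auto. Qed.

Lemma pd_mult (F G : jet -> R) (j : jet) (c : jvar) :
  differentiable_coord F j -> differentiable_coord G j ->
  pd c (fun j => F j * G j) j = pd c F j * G j + F j * pd c G j.
Proof.
intros HF HG. unfold pd. rewrite Derive_mult by auto. now rewrite upd_id.
Qed.

Lemma differentiable_coord_plus (F G : jet -> R) (j : jet) :
  differentiable_coord F j -> differentiable_coord G j ->
  differentiable_coord (fun j => F j + G j) j.
Proof. intros HF HG c. apply (ex_derive_plus (V := R_NormedModule)); auto. Qed.

Lemma differentiable_coord_minus (F G : jet -> R) (j : jet) :
  differentiable_coord F j -> differentiable_coord G j ->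
  differentiable_coord (fun j => F j - G j) j.
Proof. intros HF HG c. apply (ex_derive_minus (V := R_NormedModule)); auto. Qed.

Lemma differentiable_coord_mult (F G : jet -> R) (j : jet) :
  differentiable_coord F j -> differentiable_coord G j ->
  differentiable_coord (fun j => F j * G j) j.
Proof. intros HF HG c. apply ex_derive_mult; auto. Qed.

Lemma pd_coord (c c' : jvar) (j : jet) :
  pd c (fun j => j c') j = if jvar_beq c' c then 1 else 0.
Proof.
unfold pd, upd. destruct (jvar_beq c' c); [apply Derive_id | apply Derive_const].
Qed.

Lemma differentiable_coord_coord (c' : jvar) (j : jet) :
  differentiable_coord (fun j => j c') j.
Proof.
intros c. unfold upd. destruct (jvar_beq c' c); [apply ex_derive_id | apply ex_derive_const].
Qed.

Lemma Dx_ext (Om : R * R * R -> Prop) (F G : jet -> R) (j : jet) :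
  open Om -> (forall j, over Om j -> F j = G j) -> over Om j -> Dx F j = Dx G j.
Proof.
intros HO HFG Hj. unfold Dx. now rewrite !(pd_ext Om F G j _ HO HFG Hj).
Qed.

Lemma Dx_mult (F G : jet -> R) (j : jet) :
  differentiable_coord F j -> differentiable_coord G j ->
  Dx (fun j => F j * G j) j = Dx F j * G j + F j * Dx G j.
Proof. intros HF HG. unfold Dx. rewrite !pd_mult by auto. ring. Qed.

Lemma Dt_mult (F G : jet -> R) (j : jet) :
  differentiable_coord F j -> differentiable_coord G j ->
  Dt (fun j => F j * G j) j = Dt F j * G j + F j * Dt G j.
Proof. intros HF HG. unfold Dt. rewrite !pd_mult by auto. ring. Qed.

Lemma Dx_plus (F G : jet -> R) (j : jet) :
  differentiable_coord F j -> differentiable_coord G j ->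
  Dx (fun j => F j + G j) j = Dx F j + Dx G j.
Proof. intros HF HG. unfold Dx. rewrite !pd_plus by auto. ring. Qed.

Lemma Dx_jlift (f : R -> R -> R -> R) (j : jet) :
  Dx (jlift f) j = Derive (fun y => f (j Jt) y (j Ju)) (j Jx)
    + j Jux * Derive (fun z => f (j Jt) (j Jx) z) (j Ju).
Proof. unfold Dx, pd, jlift, upd; simpl. rewrite !Derive_const. ring. Qed.

Lemma differentiable_coord_jlift (Om : R * R * R -> Prop) f (j : jet) :
  smooth3 Om f -> over Om j -> differentiable_coord (jlift f) j.
Proof.
intros Hf Hj. destruct (Hf 1%nat _ _ _ Hj) as [_ [Ht [Hx [Hu _]]]].
intros c. destruct c; unfold jlift, upd; simpl; auto; apply ex_derive_const.
Qed.

Lemma differentiable_coord_Dx_jlift (Om : R * R * R -> Prop) f (j : jet) :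
  smooth3 Om f -> over Om j -> differentiable_coord (Dx (jlift f)) j.
Proof.
intros Hf Hj.
destruct (Hf 2%nat _ _ _ Hj) as [_ [_ [_ [_ [_ [Hx Hu]]]]]].
destruct Hx as [_ [Hxt [Hxx [Hxu _]]]]. destruct Hu as [_ [Hut [Hux [Huu _]]]].
intros c. apply ex_derive_ext with
  (fun s => jlift (fun t x u => Derive (fun y => f t y u) x) (upd j c s)
   + upd j c s Jux * jlift (fun t x u => Derive (fun z => f t x z) u) (upd j c s)).
{ intros s. now rewrite Dx_jlift. }
apply (ex_derive_plus (V := R_NormedModule)).
- destruct c; unfold jlift, upd; simpl; auto; apply ex_derive_const.
- apply ex_derive_mult; [apply (differentiable_coord_coord Jux)|].
  destruct c; unfold jlift, upd; simpl; auto; apply ex_derive_const.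
Qed.

(** * Characteristic form of the prolongation *)

Section Charact.

Variables (Om : R * R * R -> Prop) (Q : vfield).
Hypothesis Om_open : open Om.
Hypothesis tau_smooth : smooth3 Om (tau Q).
Hypothesis xi_smooth : smooth3 Om (xi Q).
Hypothesis eta_smooth : smooth3 Om (eta Q).

(** Differentiating the characteristic also hits [u_t] and [u_x]; the added terms undo this. In this
    form the prolongation simplifies on the set where the total derivatives of the characteristic
    vanish. *)
Lemma eta_t_charact (j : jet) : over Om j ->
  eta_t Q j = Dt (charact Q) j + jlift (tau Q) j * j Jutt + jlift (xi Q) j * j Jutx.
Proof.
intros Hj. unfold eta_t, Dt, charact.
assert (H1 := differentiable_coord_jlift Om _ j tau_smooth Hj).
assert (H2 := differentiable_coord_jlift Om _ j xi_smooth Hj).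
assert (H3 := differentiable_coord_jlift Om _ j eta_smooth Hj).
assert (Ht := differentiable_coord_coord Jut j).
assert (Hx := differentiable_coord_coord Jux j).
rewrite !pd_minus, !pd_mult, !pd_coord
  by auto using differentiable_coord_minus, differentiable_coord_mult.
simpl. ring.
Qed.

Lemma eta_x_charact (j : jet) : over Om j ->
  eta_x Q j = Dx (charact Q) j + jlift (tau Q) j * j Jutx + jlift (xi Q) j * j Juxx.
Proof.
intros Hj. unfold eta_x, Dx, charact.
assert (H1 := differentiable_coord_jlift Om _ j tau_smooth Hj).
assert (H2 := differentiable_coord_jlift Om _ j xi_smooth Hj).
assert (H3 := differentiable_coord_jlift Om _ j eta_smooth Hj).
assert (Ht := differentiable_coord_coord Jut j).
assert (Hx := differentiable_coord_coord Jux j).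
rewrite !pd_minus, !pd_mult, !pd_coord
  by auto using differentiable_coord_minus, differentiable_coord_mult.
simpl. ring.
Qed.

(* The third-order jet coordinates that [Dx] drops are the ones that cancel in
   the prolongation formula. *)
Lemma eta_xx_charact (j : jet) : over Om j ->
  differentiable_coord (Dx (charact Q)) j -> eta_xx Q j = Dx (Dx (charact Q)) j.
Proof.
intros Hj HF. unfold eta_xx.
rewrite (Dx_ext Om _ _ j Om_open eta_x_charact Hj).
assert (H1 := differentiable_coord_jlift Om _ j tau_smooth Hj).
assert (H2 := differentiable_coord_jlift Om _ j xi_smooth Hj).
assert (Ht := differentiable_coord_coord Jutx j).
assert (Hx := differentiable_coord_coord Juxx j).
rewrite !Dx_plus, !Dx_mult
  by auto using differentiable_coord_plus, differentiable_coord_mult.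
assert (E : Dx (fun j => j Jutx) j = 0 /\ Dx (fun j => j Juxx) j = 0).
{ unfold Dx. rewrite !pd_coord. simpl. lra. }
destruct E as [E1 E2]. rewrite E1, E2. ring.
Qed.

End Charact.

Lemma prolong2_Ljet (A B C : R -> R -> R) (Q : vfield) (j : jet) :
  prolong2 Q (Ljet A B C) j =
    jlift (tau Q) j * pd Jt (Ljet A B C) j + jlift (xi Q) j * pd Jx (Ljet A B C) j
    - C (j Jt) (j Jx) * jlift (eta Q) j + eta_t Q j
    - B (j Jt) (j Jx) * eta_x Q j - A (j Jt) (j Jx) * eta_xx Q j.
Proof.
assert (E : pd Ju (Ljet A B C) j = - C (j Jt) (j Jx) /\
  pd Jut (Ljet A B C) j = 1 /\ pd Jux (Ljet A B C) j = - B (j Jt) (j Jx) /\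
  pd Jutt (Ljet A B C) j = 0 /\ pd Jutx (Ljet A B C) j = 0 /\
  pd Juxx (Ljet A B C) j = - A (j Jt) (j Jx)).
{ unfold pd, Ljet, upd; simpl.
  repeat split; apply is_derive_unique; auto_derive; auto; ring. }
unfold prolong2. destruct E as [-> [-> [-> [-> [-> ->]]]]]. ring.
Qed.

(** With [charact Q = lam * charact Q'], every Leibniz term containing a derivative of [lam] also
    contains the characteristic of [Q'] or its [Dx] or [Dt], and these vanish at [j]. What survives
    is [lam] times the expression for [Q'], and [lam] is nonzero. *)
Lemma reduction_condition (A B C : R -> R -> R) (Om : R * R * R -> Prop)
    (Q Q' : vfield) (j : jet) : open Om ->
  is_reduction_operator A B C Om Q -> vfield_equiv Om Q Q' ->
  (forall j, over Om j -> differentiable_coord (charact Q') j) ->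
  (forall j, over Om j -> differentiable_coord (Dx (charact Q')) j) ->
  over Om j -> Ljet A B C j = 0 -> charact Q' j = 0 ->
  Dt (charact Q') j = 0 -> Dx (charact Q') j = 0 ->
  jlift (tau Q') j * (pd Jt (Ljet A B C) j + j Jutt - B (j Jt) (j Jx) * j Jutx)
  + jlift (xi Q') j * (pd Jx (Ljet A B C) j + j Jutx - B (j Jt) (j Jx) * j Juxx)
  - C (j Jt) (j Jx) * jlift (eta Q') j
  - A (j Jt) (j Jx) * Dx (Dx (charact Q')) j = 0.
Proof.
intros HO [Htau [Hxi [Heta [_ Hred]]]] [lam [Hlam Heq]] HF HDF Hj HL HF0 HDt HDx.
assert (HlF : forall j, over Om j -> charact Q j = jlift lam j * charact Q' j).
{ intros j' Hj'. destruct (Heq _ _ _ Hj') as [_ [E1 [E2 E3]]].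
  unfold charact, jlift. rewrite E1, E2, E3. ring. }
assert (HDxF : forall j, over Om j -> Dx (charact Q) j =
  Dx (jlift lam) j * charact Q' j + jlift lam j * Dx (charact Q') j).
{ intros j' Hj'. rewrite (Dx_ext Om _ _ j' HO HlF Hj'). apply Dx_mult; auto.
  now apply differentiable_coord_jlift with Om. }
assert (HDtF : Dt (charact Q) j = 0).
{ unfold Dt. rewrite !(pd_ext Om _ _ j _ HO HlF Hj).
  change (Dt (fun j => jlift lam j * charact Q' j) j = 0).
  rewrite Dt_mult, HF0, HDt; auto; [ring | now apply differentiable_coord_jlift with Om]. }
assert (Hl := differentiable_coord_jlift Om lam j Hlam Hj).
assert (HDl := differentiable_coord_Dx_jlift Om lam j Hlam Hj).
assert (HDDF : Dx (Dx (charact Q)) j = jlift lam j * Dx (Dx (charact Q')) j).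
{ rewrite (Dx_ext Om _ _ j HO HDxF Hj).
  rewrite Dx_plus, !Dx_mult by auto using differentiable_coord_mult.
  rewrite HF0, HDx. ring. }
assert (HdQ : differentiable_coord (Dx (charact Q)) j).
{ apply (differentiable_coord_ext Om
    (fun j => Dx (jlift lam) j * charact Q' j + jlift lam j * Dx (charact Q') j)); auto.
  - intros; symmetry; auto.
  - auto using differentiable_coord_plus, differentiable_coord_mult. }
assert (HDx0 : Dx (charact Q) j = 0) by (rewrite HDxF, HF0, HDx; auto; ring).
specialize (Hred j Hj HL). rewrite HlF, HF0, Rmult_0_r in Hred by auto.
specialize (Hred eq_refl HDtF HDx0).
rewrite prolong2_Ljet, (eta_t_charact Om), (eta_x_charact Om), (eta_xx_charact Om),
  HDtF, HDx0, HDDF in Hred by auto.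
destruct (Heq _ _ _ Hj) as [Hnz [E1 [E2 E3]]].
apply Rmult_eq_reg_l with (2 := Hnz). rewrite Rmult_0_r, <- Hred.
unfold jlift. rewrite E1, E2, E3. ring.
Qed.

(** * Determining equations of the reduction operators *)

Definition lift2 (g : R -> R -> R) (j : jet) : R := g (j Jt) (j Jx).

Lemma open_base (Om : R * R * R -> Prop) : open Om -> open (base Om).
Proof.
intros HO [t x] [u Hu]. destruct (HO _ Hu) as [e He].
exists e. intros q Hq. exists u. apply He. split; auto using ball_center.
Qed.

Lemma over_base (Om : R * R * R -> Prop) (j : jet) : over Om j -> base Om (j Jt, j Jx).
Proof. intros Hj. now exists (j Ju). Qed.

(** The determining relations come multiplied by [u], or mixed with it; a nonzero [u] over the given
    point lets the coefficients be extracted. *)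
Lemma base_fiber_neq0 (Om : R * R * R -> Prop) (t x : R) : open Om -> base Om (t, x) ->
  exists u, u <> 0 /\ Om (t, x, u).
Proof.
intros HO [u Hu]. destruct (Req_dec u 0) as [->|Hnz]; [|now exists u].
destruct (HO _ Hu) as [e He]. assert (Hp := cond_pos e). exists (e / 2). split; [lra|].
apply He. split; [apply ball_center|].
change (Rabs (e / 2 - 0) < e). rewrite Rminus_0_r, Rabs_pos_eq; lra.
Qed.

Section Lift2.

Variables (D : R * R -> Prop) (g : R -> R -> R) (j : jet).
Hypothesis g_smooth : smoothN 1 D g.
Hypothesis Dj : D (j Jt, j Jx).

Lemma differentiable_coord_lift2 : differentiable_coord (lift2 g) j.
Proof.
intros c. destruct (g_smooth _ _ Dj) as [_ [Ht [Hx _]]].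
destruct c; unfold lift2, upd; simpl; auto; apply ex_derive_const.
Qed.

Lemma Dx_lift2 : Dx (lift2 g) j = lift2 (d_x g) j.
Proof. unfold Dx, pd, lift2, upd, d_x; simpl. rewrite !Derive_const. ring. Qed.

Lemma Dt_lift2 : Dt (lift2 g) j = lift2 (d_t g) j.
Proof. unfold Dt, pd, lift2, upd, d_t; simpl. rewrite !Derive_const. ring. Qed.

End Lift2.

Lemma Dx_minus (F G : jet -> R) (j : jet) :
  differentiable_coord F j -> differentiable_coord G j ->
  Dx (fun j => F j - G j) j = Dx F j - Dx G j.
Proof. intros HF HG. unfold Dx. rewrite !pd_minus by auto. ring. Qed.

Lemma Dt_minus (F G : jet -> R) (j : jet) :
  differentiable_coord F j -> differentiable_coord G j ->
  Dt (fun j => F j - G j) j = Dt F j - Dt G j.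
Proof. intros HF HG. unfold Dt. rewrite !pd_minus by auto. ring. Qed.

Lemma Dx_coord (c : jvar) (j : jet) : Dx (fun j => j c) j =
  match c with Jx => 1 | Ju => j Jux | Jut => j Jutx | Jux => j Juxx | _ => 0 end.
Proof. unfold Dx. rewrite !pd_coord. destruct c; simpl; ring. Qed.

Lemma Dt_coord (c : jvar) (j : jet) : Dt (fun j => j c) j =
  match c with Jt => 1 | Ju => j Jut | Jut => j Jutt | Jux => j Jutx | _ => 0 end.
Proof. unfold Dt. rewrite !pd_coord. destruct c; simpl; ring. Qed.

Lemma pd_Jt_Ljet (A B C : R -> R -> R) (D : R * R -> Prop) (j : jet) :
  smoothN 1 D A -> smoothN 1 D B -> smoothN 1 D C -> D (j Jt, j Jx) ->
  pd Jt (Ljet A B C) j = - lift2 (d_t A) j * j Juxx - lift2 (d_t B) j * j Jux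
    - lift2 (d_t C) j * j Ju.
Proof.
intros HA HB HC Dj. unfold pd, Ljet, lift2, d_t, upd; simpl.
destruct (HA _ _ Dj) as [_ [HA' _]]. destruct (HB _ _ Dj) as [_ [HB' _]].
destruct (HC _ _ Dj) as [_ [HC' _]].
apply is_derive_unique. auto_derive; [tauto | ring].
Qed.

Lemma pd_Jx_Ljet (A B C : R -> R -> R) (D : R * R -> Prop) (j : jet) :
  smoothN 1 D A -> smoothN 1 D B -> smoothN 1 D C -> D (j Jt, j Jx) ->
  pd Jx (Ljet A B C) j = - lift2 (d_x A) j * j Juxx - lift2 (d_x B) j * j Jux
    - lift2 (d_x C) j * j Ju.
Proof.
intros HA HB HC Dj. unfold pd, Ljet, lift2, d_x, upd; simpl.
destruct (HA _ _ Dj) as [_ [_ [HA' _]]]. destruct (HB _ _ Dj) as [_ [_ [HB' _]]].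
destruct (HC _ _ Dj) as [_ [_ [HC' _]]].
apply is_derive_unique. auto_derive; [tauto | ring].
Qed.

Definition mkjet (t x u ut ux utt utx uxx : R) : jet := fun c =>
  match c with
  | Jt => t | Jx => x | Ju => u | Jut => ut | Jux => ux
  | Jutt => utt | Jutx => utx | Juxx => uxx
  end.

Local Hint Resolve differentiable_coord_plus differentiable_coord_minus
  differentiable_coord_mult differentiable_coord_coord : dcoord.

(** The constraints leave [u] as the only free fiber coordinate that matters: the characteristic
    gives [u_x], its [Dx] gives [u_xx], the equation gives [u_t], and [Dt] gives [u_tx]. The
    condition becomes [u] times the difference of the two sides. *)
Lemma determining_equation_x (A B C eta1 : R -> R -> R) (Om : R * R * R -> Prop)
    (Q : vfield) (t x : R) : open Om ->
  is_reduction_operator A B C Om Q ->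
  vfield_equiv Om Q
    (VField (fun _ _ _ => 0) (fun _ _ _ => 1) (fun t x u => eta1 t x * u)) ->
  (forall n, smoothN n (base Om) A) -> (forall n, smoothN n (base Om) B) ->
  (forall n, smoothN n (base Om) C) -> (forall n, smoothN n (base Om) eta1) ->
  base Om (t, x) ->
  d_t eta1 t x =
    d_x A t x * (d_x eta1 t x + eta1 t x * eta1 t x)
    + A t x * (d_x (d_x eta1) t x + 2 * eta1 t x * d_x eta1 t x)
    + d_x B t x * eta1 t x + B t x * d_x eta1 t x + d_x C t x.
Proof.
intros HO HQ Heq HA HB HC He Htx.
destruct (base_fiber_neq0 Om t x HO Htx) as [u [Hu Hom]].
set (Q' := VField _ _ _) in Heq.
assert (HF : charact Q' = fun j => lift2 eta1 j * j Ju - j Jux).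
{ apply functional_extensionality. intros j. unfold charact, jlift, lift2. simpl. ring. }
assert (Hd : forall j, over Om j -> differentiable_coord (lift2 eta1) j).
{ intros j Hj. apply differentiable_coord_lift2 with (base Om); auto using over_base. }
assert (Hdx : forall j, over Om j -> differentiable_coord (lift2 (d_x eta1)) j).
{ intros j Hj. apply differentiable_coord_lift2 with (base Om);
  auto using over_base, smoothN_d_x. }
assert (HDxF : forall j, over Om j -> Dx (charact Q') j =
  lift2 (d_x eta1) j * j Ju + lift2 eta1 j * j Jux - j Juxx).
{ intros j Hj. rewrite HF, Dx_minus, Dx_mult, Dx_lift2, !Dx_coord by auto with dcoord.
  ring. }
set (ux := eta1 t x * u). set (uxx := d_x eta1 t x * u + eta1 t x * ux).
set (ut := A t x * uxx + B t x * ux + C t x * u).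
set (utx := d_t eta1 t x * u + eta1 t x * ut).
(* [u_tt] enters the condition only with the factor [tau], which is zero here, and enters no
   constraint; 0 is a default. *)
set (j := mkjet t x u ut ux 0 utx uxx).
assert (Hj : over Om j) by exact Hom.
assert (HR := reduction_condition A B C Om Q Q' j HO HQ Heq).
assert (HDDF : Dx (Dx (charact Q')) j = d_x (d_x eta1) t x * u
  + 2 * d_x eta1 t x * ux + eta1 t x * uxx).
{ rewrite (Dx_ext Om _ _ j HO HDxF Hj).
  rewrite Dx_minus, Dx_plus, !Dx_mult, !Dx_lift2, !Dx_coord by auto with dcoord.
  unfold lift2; simpl. ring. }
rewrite HDDF, (pd_Jx_Ljet _ _ _ (base Om)) in HR by auto.
assert (HG : u * (d_t eta1 t x - (d_x A t x * (d_x eta1 t x + eta1 t x * eta1 t x)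
    + A t x * (d_x (d_x eta1) t x + 2 * eta1 t x * d_x eta1 t x)
    + d_x B t x * eta1 t x + B t x * d_x eta1 t x + d_x C t x)) = 0).
{ rewrite <- HR; auto.
  - unfold jlift, lift2, utx, ut, uxx, ux; simpl. unfold utx, ut, uxx, ux. ring.
  - intros k Hk. rewrite HF. auto with dcoord.
  - intros k Hk. apply (differentiable_coord_ext Om
      (fun j => lift2 (d_x eta1) j * j Ju + lift2 eta1 j * j Jux - j Juxx)); auto.
    + intros; symmetry; auto.
    + auto 6 with dcoord.
  - unfold Ljet; simpl. unfold ut. ring.
  - rewrite HF. unfold lift2; simpl. unfold ux. ring.
  - rewrite HF, Dt_minus, Dt_mult, Dt_lift2, !Dt_coord by auto with dcoord.
    unfold lift2; simpl. unfold utx. ring.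
  - rewrite HDxF by auto. unfold lift2; simpl. unfold uxx. ring. }
apply Rmult_integral in HG as [HG|HG]; [contradiction | lra].
Qed.

(** Here [u] and [p = u_x] stay free. The characteristic determines [u_t], the equation [u_xx] (by
    division by [A]), and the total derivatives of the characteristic [u_tx] and [u_tt]. *)
Lemma determining_equation_t (A B C g1 g2 : R -> R -> R) (Om : R * R * R -> Prop)
    (Q : vfield) (t x u p : R) : open Om ->
  is_reduction_operator A B C Om Q ->
  vfield_equiv Om Q
    (VField (fun _ _ _ => 1) (fun t x _ => g1 t x) (fun t x u => g2 t x * u)) ->
  (forall n, smoothN n (base Om) A) -> (forall n, smoothN n (base Om) B) ->
  (forall n, smoothN n (base Om) C) ->
  (forall n, smoothN n (base Om) g1) -> (forall n, smoothN n (base Om) g2) ->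
  A t x <> 0 -> Om (t, x, u) ->
  let ut := g2 t x * u - g1 t x * p in
  let uxx := (ut - B t x * p - C t x * u) / A t x in
  let utx := d_x g2 t x * u + g2 t x * p - d_x g1 t x * p - g1 t x * uxx in
  let utt := d_t g2 t x * u + g2 t x * ut - d_t g1 t x * p - g1 t x * utx in
  (- d_t A t x * uxx - d_t B t x * p - d_t C t x * u + utt - B t x * utx)
  + g1 t x * (- d_x A t x * uxx - d_x B t x * p - d_x C t x * u + utx - B t x * uxx)
  - C t x * (g2 t x * u)
  - A t x * (d_x (d_x g2) t x * u + 2 * d_x g2 t x * p + g2 t x * uxx
             - d_x (d_x g1) t x * p - 2 * d_x g1 t x * uxx) = 0.
Proof.
intros HO HQ Heq HA HB HC Hg1 Hg2 Hnz Hom ut uxx utx utt.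
set (Q' := VField _ _ _) in Heq.
assert (HF : charact Q' = fun j => lift2 g2 j * j Ju - j Jut - lift2 g1 j * j Jux).
{ apply functional_extensionality. intros j. unfold charact, jlift, lift2. simpl. ring. }
assert (Hd : forall g j, (forall n, smoothN n (base Om) g) -> over Om j ->
  differentiable_coord (lift2 g) j).
{ intros g j Hg Hj. apply differentiable_coord_lift2 with (base Om); auto using over_base. }
assert (Hd1 := fun j => Hd g1 j Hg1). assert (Hd2 := fun j => Hd g2 j Hg2).
assert (Hd1x : forall j, over Om j -> differentiable_coord (lift2 (d_x g1)) j).
{ intros j Hj. apply Hd; auto using smoothN_d_x. }
assert (Hd2x : forall j, over Om j -> differentiable_coord (lift2 (d_x g2)) j).
{ intros j Hj. apply Hd; auto using smoothN_d_x. }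
assert (HDxF : forall j, over Om j -> Dx (charact Q') j =
  lift2 (d_x g2) j * j Ju + lift2 g2 j * j Jux - j Jutx
  - (lift2 (d_x g1) j * j Jux + lift2 g1 j * j Juxx)).
{ intros j Hj. rewrite HF, !Dx_minus, !Dx_mult, !Dx_lift2, !Dx_coord by auto with dcoord.
  ring. }
set (j := mkjet t x u ut p utt utx uxx).
assert (Hj : over Om j) by exact Hom.
assert (HR := reduction_condition A B C Om Q Q' j HO HQ Heq).
assert (HDDF : Dx (Dx (charact Q')) j = d_x (d_x g2) t x * u + 2 * d_x g2 t x * p
  + g2 t x * uxx - d_x (d_x g1) t x * p - 2 * d_x g1 t x * uxx).
{ rewrite (Dx_ext Om _ _ j HO HDxF Hj).
  rewrite !Dx_minus, !Dx_plus, !Dx_mult, !Dx_lift2, !Dx_coord by auto 6 with dcoord.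
  unfold lift2; simpl. ring. }
assert (HB0 : base Om (j Jt, j Jx)) by now apply over_base.
rewrite HDDF, (pd_Jx_Ljet _ _ _ (base Om)), (pd_Jt_Ljet _ _ _ (base Om)) in HR by auto.
rewrite <- HR; auto.
- unfold jlift, lift2; simpl. ring.
- intros k Hk. rewrite HF. auto with dcoord.
- intros k Hk. apply (differentiable_coord_ext Om
    (fun j => lift2 (d_x g2) j * j Ju + lift2 g2 j * j Jux - j Jutx
      - (lift2 (d_x g1) j * j Jux + lift2 g1 j * j Juxx))); auto.
  + intros; symmetry; auto.
  + auto 7 with dcoord.
- unfold Ljet; simpl. unfold uxx. field. auto.
- rewrite HF. unfold lift2; simpl. unfold ut. ring.
- rewrite HF, !Dt_minus, !Dt_mult, !Dt_lift2, !Dt_coord by auto with dcoord.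
  unfold lift2; simpl. unfold utt. ring.
- rewrite HDxF by auto. unfold lift2; simpl. unfold utx. ring.
Qed.

(* The index [true] stands for [psi] and [false] for [psi_x]. *)
Definition conn_x (P q : R -> R -> R) (i j : bool) : R -> R -> R :=
  match i, j with
  | true, true => fun _ _ => 0
  | true, false => fun _ _ => 1
  | false, true => P
  | false, false => q
  end.

(** The second row is the [x]-derivative of [psi_t = g2 psi - g1 psi_x] in which [psi_xx] is
    replaced by [P psi + q psi_x]. *)
Definition conn_t (g1 g2 P q : R -> R -> R) (i j : bool) : R -> R -> R :=
  match i, j with
  | true, true => g2
  | true, false => fun t x => - g1 t x
  | false, true => fun t x => d_x g2 t x - g1 t x * P t x
  | false, false => fun t x => g2 t x - d_x g1 t x - g1 t x * q t x
  end.

(** The first row of the curvature vanishes identically, by the way the second row of [conn_t] was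
    obtained. The two entries of the second row, times [A], are the coefficients of [u] and [u_x] in
    the reduction condition. *)
Lemma flat_reduction (A B C g1 g2 : R -> R -> R) (Om : R * R * R -> Prop)
    (Q : vfield) : open Om ->
  is_reduction_operator A B C Om Q ->
  vfield_equiv Om Q
    (VField (fun _ _ _ => 1) (fun t x _ => g1 t x) (fun t x u => g2 t x * u)) ->
  (forall n, smoothN n (base Om) A) -> (forall n, smoothN n (base Om) B) ->
  (forall n, smoothN n (base Om) C) ->
  (forall n, smoothN n (base Om) g1) -> (forall n, smoothN n (base Om) g2) ->
  (forall t x, base Om (t, x) -> A t x <> 0) ->
  let P := fun t x => (g2 t x - C t x) / A t x in
  let q := fun t x => - (g1 t x + B t x) / A t x in
  flat (base Om) (conn_x P q) (conn_t g1 g2 P q).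
Proof.
intros HO HQ Heq HA HB HC Hg1 Hg2 Hnz P q.
assert (Hder : forall f t x, (forall n, smoothN n (base Om) f) -> base Om (t, x) ->
  ex_derive (fun s => f s x) t /\ ex_derive (fun y => f t y) x).
{ intros f t x Hf Htx. destruct (Hf 1%nat t x Htx) as [_ [H1 [H2 _]]]. auto. }
assert (HPt : forall t x, base Om (t, x) -> is_derive (fun s => P s x) t
  ((d_t g2 t x - d_t C t x - P t x * d_t A t x) / A t x) /\
  is_derive (fun s => q s x) t
  ((- d_t g1 t x - d_t B t x - q t x * d_t A t x) / A t x)).
{ intros t x Htx. destruct (Hder A t x HA Htx), (Hder B t x HB Htx),
    (Hder C t x HC Htx), (Hder g1 t x Hg1 Htx), (Hder g2 t x Hg2 Htx).
  assert (HAn := Hnz t x Htx).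
  unfold P, q, d_t. split; auto_derive; auto; field; auto. }
assert (HPx : forall t x, base Om (t, x) -> is_derive (fun y => P t y) x
  ((d_x g2 t x - d_x C t x - P t x * d_x A t x) / A t x) /\
  is_derive (fun y => q t y) x
  ((- d_x g1 t x - d_x B t x - q t x * d_x A t x) / A t x)).
{ intros t x Htx. destruct (Hder A t x HA Htx), (Hder B t x HB Htx),
    (Hder C t x HC Htx), (Hder g1 t x Hg1 Htx), (Hder g2 t x Hg2 Htx).
  assert (HAn := Hnz t x Htx).
  unfold P, q, d_x. split; auto_derive; auto; field; auto. }
intros i j t x Htx.
assert (HAn := Hnz t x Htx).
destruct (base_fiber_neq0 Om t x HO Htx) as [u [Hu Hom]].
assert (HE := fun p => determining_equation_t A B C g1 g2 Om Q t x u p HO HQ Heq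
  HA HB HC Hg1 Hg2 HAn Hom). cbv zeta in HE.
destruct (HPt t x Htx) as [HP1 HP2].
assert (HP1' := is_derive_unique _ _ _ HP1 : d_t P t x = _).
assert (HP2' := is_derive_unique _ _ _ HP2 : d_t q t x = _).
destruct (HPx t x Htx) as [HP3 HP4].
destruct (Hder g1 t x Hg1 Htx) as [_ D1]. destruct (Hder g2 t x Hg2 Htx) as [_ D2].
destruct (Hder (d_x g1) t x (fun n => smoothN_d_x n _ _ (Hg1 (S n))) Htx) as [_ D3].
destruct (Hder (d_x g2) t x (fun n => smoothN_d_x n _ _ (Hg2 (S n))) Htx) as [_ D4].
assert (HN1 : d_x (fun t x => d_x g2 t x - g1 t x * P t x) t x =
  d_x (d_x g2) t x - (d_x g1 t x * P t x
    + g1 t x * ((d_x g2 t x - d_x C t x - P t x * d_x A t x) / A t x))).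
{ apply is_derive_unique. apply (is_derive_minus (V := R_NormedModule)).
  - now apply Derive_correct.
  - apply (is_derive_mult (fun y => g1 t y) (fun y => P t y));
      [now apply Derive_correct | exact HP3 | intros; apply Rmult_comm]. }
assert (HN2 : d_x (fun t x => g2 t x - d_x g1 t x - g1 t x * q t x) t x =
  d_x g2 t x - d_x (d_x g1) t x - (d_x g1 t x * q t x
    + g1 t x * ((- d_x g1 t x - d_x B t x - q t x * d_x A t x) / A t x))).
{ apply is_derive_unique. apply (is_derive_minus (V := R_NormedModule)).
  - apply (is_derive_minus (V := R_NormedModule)); now apply Derive_correct.
  - apply (is_derive_mult (fun y => g1 t y) (fun y => q t y));
      [now apply Derive_correct | exact HP4 | intros; apply Rmult_comm]. }
set (X := d_t P t x + mx (fun i j => conn_x P q i j t x)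
    (fun i j => conn_t g1 g2 P q i j t x) false true
  - (d_x (fun t x => d_x g2 t x - g1 t x * P t x) t x
     + mx (fun i j => conn_t g1 g2 P q i j t x) (fun i j => conn_x P q i j t x) false true)).
set (Y := d_t q t x + mx (fun i j => conn_x P q i j t x)
    (fun i j => conn_t g1 g2 P q i j t x) false false
  - (d_x (fun t x => g2 t x - d_x g1 t x - g1 t x * q t x) t x
     + mx (fun i j => conn_t g1 g2 P q i j t x) (fun i j => conn_x P q i j t x) false false)).
(* The slope [p] is arbitrary while [u] is fixed and nonzero: [p = 0] will give [X = 0], and then
   [p = 1] gives [Y = 0]. *)
assert (HXY : forall p, u * X + p * Y = 0).
{ intros p. apply Rmult_eq_reg_l with (2 := HAn). rewrite Rmult_0_r, <- (HE p).
  unfold X, Y. rewrite HN1, HN2. rewrite HP1', HP2'.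
  unfold mx, mv, conn_x, conn_t, P, q. field. auto. }
assert (HX : X = 0).
{ specialize (HXY 0). rewrite Rmult_0_l, Rplus_0_r in HXY.
  apply Rmult_integral in HXY as [|]; [contradiction | auto]. }
assert (HY : Y = 0) by (specialize (HXY 1); rewrite HX in HXY; lra).
destruct i, j.
- unfold mx, mv, conn_x, conn_t, d_t. rewrite Derive_const. ring.
- replace (d_x (conn_t g1 g2 P q true false) t x) with (- d_x g1 t x)
    by (symmetry; apply Derive_opp).
  unfold mx, mv, conn_x, conn_t, d_t. rewrite Derive_const. ring.
- now apply Rminus_diag_uniq.
- now apply Rminus_diag_uniq.
Qed.

(** * Darboux operators *)

Lemma wronskian1 (f : R -> R -> R) (t x : R) : wronskian [f] t x = f t x.
Proof. unfold wronskian. simpl. ring. Qed.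

Lemma wronskian2 (f g : R -> R -> R) (t x : R) :
  wronskian [f; g] t x = f t x * d_x g t x - g t x * d_x f t x.
Proof. unfold wronskian, d_x. simpl. ring. Qed.

Lemma wronskian3 (f g h : R -> R -> R) (t x : R) :
  wronskian [f; g; h] t x =
    f t x * (d_x g t x * d_x (d_x h) t x - d_x h t x * d_x (d_x g) t x)
    - g t x * (d_x f t x * d_x (d_x h) t x - d_x h t x * d_x (d_x f) t x)
    + h t x * (d_x f t x * d_x (d_x g) t x - d_x g t x * d_x (d_x f) t x).
Proof. unfold wronskian, d_x. simpl. ring. Qed.

(** A first-order system delivers the second [x]-derivative only as a derivative of the other
    component [v']. Since [v'] agrees with [d_x v] on an open set, it can be transferred to [v]. *)
Lemma is_solution_intro (A B C : R -> R -> R) (U : R * R -> Prop)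
    (v v' vt vxx : R -> R -> R) : open U -> smooth2 U v ->
  (forall t x, U (t, x) -> is_derive (fun s => v s x) t (vt t x)) ->
  (forall t x, U (t, x) -> is_derive (fun y => v t y) x (v' t x)) ->
  (forall t x, U (t, x) -> is_derive (fun y => v' t y) x (vxx t x)) ->
  (forall t x, U (t, x) -> vt t x = A t x * vxx t x + B t x * v' t x + C t x * v t x) ->
  is_solution A B C U v /\
  forall t x, U (t, x) -> d_x v t x = v' t x /\ d_x (d_x v) t x = vxx t x.
Proof.
intros HU Hv Ht Hx Hxx Heq.
assert (H1 : forall t x, U (t, x) -> d_x v t x = v' t x).
{ intros t x Utx. apply is_derive_unique. auto. }
assert (H2 : forall t x, U (t, x) -> d_x (d_x v) t x = vxx t x).
{ intros t x Utx. apply is_derive_unique.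
  apply is_derive_ext_loc with (fun y => v' t y); auto.
  generalize (open_locally_x U t x HU Utx). apply filter_imp.
  intros y Hy. symmetry. auto. }
split; [split; auto|auto].
intros t x Utx.
change (Derive_n (fun y => v t y) 2 x) with (d_x (d_x v) t x).
change (Derive (fun y => v t y) x) with (d_x v t x).
rewrite H1, H2, <- Heq by auto. apply is_derive_unique. auto.
Qed.

Lemma is_solution_sub (A B C : R -> R -> R) (U U' : R * R -> Prop) v :
  (forall p, U' p -> U p) -> is_solution A B C U v -> is_solution A B C U' v.
Proof. intros H [H1 H2]. split; [intros n t x Htx; apply H1 | intros t x Htx; apply H2]; auto. Qed.

Lemma neq0_ball (f : R -> R -> R) (t0 x0 : R) (r : posreal) :
  continuity_2d_pt f t0 x0 -> f t0 x0 <> 0 ->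
  exists r' : posreal,
    (forall p, ball ((t0, x0) : R * R) r' p -> ball ((t0, x0) : R * R) r p) /\
    forall t x, ball ((t0, x0) : R * R) r' (t, x) -> f t x <> 0.
Proof.
intros Hc Hf. destruct (continuity_2d_pt_neq_0 f t0 x0 Hc Hf) as [d Hd].
exists (mkposreal _ (Rmin_pos _ _ (cond_pos r) (cond_pos d))). simpl. split.
- intros p. apply ball_le. apply Rmin_l.
- intros t x Htx. apply (ball_le _ _ _ (Rmin_r r d)), ball_box in Htx as [Ht Hx]. auto.
Qed.

(** The multiplier does not vanish, so whether [tau] is zero decides which of the two normal forms
    [Q] can have. *)
Lemma equiv_coef_tau (Om : R * R * R -> Prop) (Q : vfield) (k : R)
    (xi' eta' : R -> R -> R -> R) (t x u : R) :
  vfield_equiv Om Q (VField (fun _ _ _ => k) xi' eta') -> Om (t, x, u) ->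
  (tau Q t x u = 0 <-> k = 0).
Proof.
intros [lam [_ H]] Hom. destruct (H _ _ _ Hom) as [Hl [E _]]. rewrite E. simpl.
split; [|intros ->; ring]. intros E0. apply Rmult_integral in E0 as [|]; tauto.
Qed.

Section Darboux.

Variables (A B C : R -> R -> R) (Om : R * R * R -> Prop) (Q : vfield) (Qt : lop).
Hypothesis Om_open : open Om.
Hypothesis A_smooth : forall n, smoothN n (base Om) A.
Hypothesis B_smooth : forall n, smoothN n (base Om) B.
Hypothesis C_smooth : forall n, smoothN n (base Om) C.
Hypothesis A_neq0 : forall t x, base Om (t, x) -> A t x <> 0.
Hypothesis Q_reduction : is_reduction_operator A B C Om Q.

Lemma darboux_one (eta1 : R -> R -> R) :
  smooth2 (base Om) eta1 ->
  vfield_equiv Om Q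
    (VField (fun _ _ _ => 0) (fun _ _ _ => 1) (fun t x u => eta1 t x * u)) ->
  (forall t x, base Om (t, x) ->
     c_t Qt t x = 0 /\ c_x Qt t x = -1 /\ c_0 Qt t x = eta1 t x) ->
  locally_darboux A B C (base Om) Qt 1.
Proof.
intros He Heq HQt t0 x0 H0.
assert (HW := open_base Om Om_open).
assert (He' : forall n, smoothN n (base Om) eta1) by now apply smooth2_smoothN.
(* [nt] is the coefficient in [psi_t = nt psi] obtained by inserting [psi_x = eta1 psi] in the
   equation. This rank-one connection is padded with zeros to size two, so that [frobenius] serves
   both cases. *)
set (nt := fun t x => A t x * (d_x eta1 t x + eta1 t x * eta1 t x) + B t x * eta1 t x + C t x).
set (m := fun i j : bool => if andb i j then eta1 else fun _ _ : R => 0).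
set (n := fun i j : bool => if andb i j then nt else fun _ _ : R => 0).
destruct (frobenius (base Om) m n t0 x0) as [r [Hr Hv]]; auto.
{ intros i j. apply smooth2_smoothN. intros k. unfold m.
  destruct (andb i j); auto using smoothN_const. }
{ intros i j. apply smooth2_smoothN. intros k. unfold n, nt.
  destruct (andb i j); auto using smoothN_const.
  auto 7 using smoothN_plus, smoothN_mult, smoothN_d_x. }
{ intros i j t x Htx. unfold mx, mv, m, n.
  assert (Hc : d_t (fun _ _ => 0) t x = 0 /\ d_x (fun _ _ => 0) t x = 0)
    by (unfold d_t, d_x; now rewrite !Derive_const).
  destruct Hc as [Hc1 Hc2].
  destruct i, j; simpl; rewrite ?Hc1, ?Hc2; try ring.
  rewrite (determining_equation_x A B C eta1 Om Q t x) by auto.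
  replace (d_x nt t x) with
    (d_x A t x * (d_x eta1 t x + eta1 t x * eta1 t x)
    + A t x * (d_x (d_x eta1) t x + 2 * eta1 t x * d_x eta1 t x)
    + d_x B t x * eta1 t x + B t x * d_x eta1 t x + d_x C t x); [ring|].
  symmetry. apply is_derive_unique. unfold nt.
  assert (HA' := smoothN_is_derive_x 0 _ A t x (A_smooth 1) Htx).
  assert (HB' := smoothN_is_derive_x 0 _ B t x (B_smooth 1) Htx).
  assert (HC' := smoothN_is_derive_x 0 _ C t x (C_smooth 1) Htx).
  assert (H1 := smoothN_is_derive_x 0 _ eta1 t x (He' 1%nat) Htx).
  assert (H2 := smoothN_is_derive_x 0 _ (d_x eta1) t x
    (smoothN_d_x 1 _ _ (He' 2%nat)) Htx).
  unfold d_x at 1.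
  auto_derive.
  - repeat split; auto; eexists; eauto.
  - unfold d_x. ring. }
destruct (Hv (fun i => if i then 1 else 0)) as [v [Hv0 [Hvs Hvd]]].
destruct (neq0_ball (v true) t0 x0 r) as [r' [Hr' Hnz]].
{ apply (Hvs true 0%nat). apply ball_center. }
{ rewrite Hv0. lra. }
set (U := ball ((t0, x0) : R * R) r').
assert (HU : forall p, U p -> base Om p) by (intros; apply Hr, Hr'; auto).
assert (Hx : forall t x, U (t, x) ->
  is_derive (fun y => v true t y) x (eta1 t x * v true t x)).
{ intros t x Htx. destruct (Hvd true t x (Hr' _ Htx)) as [_ H].
  unfold mv, m in H; simpl in H. rewrite Rmult_0_l, Rplus_0_r in H. exact H. }
destruct (is_solution_intro A B C U (v true) (fun t x => eta1 t x * v true t x)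
  (fun t x => nt t x * v true t x)
  (fun t x => d_x eta1 t x * v true t x + eta1 t x * (eta1 t x * v true t x)))
  as [Hsol Hder]; auto.
{ apply open_ball_box. }
{ intros k t x Htx. apply Hvs. now apply Hr'. }
{ intros t x Htx. destruct (Hvd true t x (Hr' _ Htx)) as [H _].
  unfold mv, n in H; simpl in H. rewrite Rmult_0_l, Rplus_0_r in H. exact H. }
{ intros t x Htx. apply (is_derive_mult (fun y => eta1 t y) (fun y => v true t y)).
  - apply (smoothN_is_derive_x 0 (base Om)); auto.
  - auto.
  - intros; apply Rmult_comm. }
{ intros t x Htx. unfold nt. ring. }
exists r', [v true]. cbv zeta. fold U. split; [|split; [|split; [|split; [|split]]]]; auto.
- intros c Hc [|k] Hk; [|simpl in Hk; lia].
  specialize (Hc t0 x0 (ball_center _ _)). simpl in Hc. rewrite sum_O in Hc.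
  apply Rmult_integral in Hc as [Hc|Hc]; auto. rewrite Hv0 in Hc. lra.
- intros t x Htx. rewrite wronskian1. auto.
(* The operator attached to [Q] is [- d_x + eta1] with [eta1 = psi_x / psi], the opposite of the
   Darboux operator. *)
- exists (fun _ _ => -1). split; [|split].
  + apply smooth2_smoothN. intros; apply smoothN_const.
  + intros; lra.
  + intros V u HV HVU [Hu Hueq] t x Htx. assert (Utx := HVU _ Htx).
    unfold lapply, darboux. simpl app. rewrite wronskian1, wronskian2.
    destruct (HQt t x (HU _ Utx)) as [-> [-> ->]].
    rewrite (proj1 (Hder t x Utx)). unfold d_x. field. auto.
Qed.

Lemma darboux_two (g1 g2 : R -> R -> R) :
  smooth2 (base Om) g1 -> smooth2 (base Om) g2 ->
  vfield_equiv Om Q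
    (VField (fun _ _ _ => 1) (fun t x _ => g1 t x) (fun t x u => g2 t x * u)) ->
  (forall t x, base Om (t, x) ->
     c_t Qt t x = -1 /\ c_x Qt t x = - g1 t x /\ c_0 Qt t x = g2 t x) ->
  locally_darboux A B C (base Om) Qt 2.
Proof.
intros Hg1 Hg2 Heq HQt t0 x0 H0.
assert (HW := open_base Om Om_open).
assert (Hg1' : forall n, smoothN n (base Om) g1) by now apply smooth2_smoothN.
assert (Hg2' : forall n, smoothN n (base Om) g2) by now apply smooth2_smoothN.
assert (Hflat := flat_reduction A B C g1 g2 Om Q Om_open Q_reduction Heq
  A_smooth B_smooth C_smooth Hg1' Hg2' A_neq0).
set (P := fun t x => (g2 t x - C t x) / A t x) in Hflat.
set (q := fun t x => - (g1 t x + B t x) / A t x) in Hflat.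
cbv zeta in Hflat.
assert (HP : forall n, smoothN n (base Om) P).
{ intros n. unfold P, Rdiv, Rminus.
  auto 7 using smoothN_plus, smoothN_mult, smoothN_opp, smoothN_inv. }
assert (Hq : forall n, smoothN n (base Om) q).
{ intros n. unfold q, Rdiv.
  apply smoothN_mult; auto using smoothN_inv.
  apply smoothN_opp; auto using smoothN_plus. }
destruct (frobenius (base Om) (conn_x P q) (conn_t g1 g2 P q) t0 x0) as [r [Hr Hv]]; auto.
{ intros i j. apply smooth2_smoothN. intros k.
  destruct i, j; simpl; auto using smoothN_const. }
{ intros i j. apply smooth2_smoothN. intros k. unfold conn_t, Rminus.
  destruct i, j; auto 9 using smoothN_plus, smoothN_mult, smoothN_opp, smoothN_d_x. }
assert (Hsol : forall c, exists v v' : R -> R -> R,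
  v t0 x0 = c true /\ v' t0 x0 = c false /\
  smooth2 (ball ((t0, x0) : R * R) r) v' /\
  is_solution A B C (ball ((t0, x0) : R * R) r) v /\
  forall t x, ball ((t0, x0) : R * R) r (t, x) ->
    d_x v t x = v' t x /\ d_x (d_x v) t x = P t x * v t x + q t x * v' t x).
{ intros c. destruct (Hv c) as [v [Hv0 [Hvs Hvd]]].
  exists (v true), (v false). rewrite !Hv0. do 3 (split; auto).
  apply (is_solution_intro A B C _ (v true) (v false)
    (fun t x => g2 t x * v true t x - g1 t x * v false t x)); auto using open_ball_box.
  - intros t x Htx. destruct (Hvd true t x Htx) as [H _].
    unfold mv, conn_t in H.
    replace (g2 t x * v true t x - g1 t x * v false t x)
      with (g2 t x * v true t x + - g1 t x * v false t x) by ring. exact H.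
  - intros t x Htx. destruct (Hvd true t x Htx) as [_ H].
    unfold mv, conn_x in H. rewrite Rmult_0_l, Rplus_0_l, Rmult_1_l in H. exact H.
  - intros t x Htx. apply (Hvd false t x Htx).
  - intros t x Htx. unfold P, q. field. apply A_neq0. auto. }
(* Unit initial vectors for [(psi, psi_x)], so that the Wronskian equals 1 at the center and, by
   continuity, is nonzero nearby. *)
destruct (Hsol (fun i => if i then 1 else 0)) as [v1 [w1 [Hv10 [Hw10 [Hw1 [S1 E1]]]]]].
destruct (Hsol (fun i => if i then 0 else 1)) as [v2 [w2 [Hv20 [Hw20 [Hw2 [S2 E2]]]]]].
destruct (neq0_ball (fun t x => v1 t x * w2 t x - v2 t x * w1 t x) t0 x0 r)
  as [r' [Hr' Hnz]].
{ apply continuity_2d_pt_minus; apply continuity_2d_pt_mult.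
  - apply (proj1 S1 0%nat), ball_center.
  - apply (Hw2 0%nat), ball_center.
  - apply (proj1 S2 0%nat), ball_center.
  - apply (Hw1 0%nat), ball_center. }
{ rewrite Hv10, Hw10, Hv20, Hw20. lra. }
set (U := ball ((t0, x0) : R * R) r') in *.
assert (HU : forall p, U p -> base Om p) by (intros; apply Hr, Hr'; auto).
assert (HW2 : forall t x, U (t, x) -> wronskian [v1; v2] t x <> 0).
{ intros t x Htx. rewrite wronskian2.
  rewrite (proj1 (E1 t x (Hr' _ Htx))), (proj1 (E2 t x (Hr' _ Htx))). auto. }
exists r', [v1; v2]. cbv zeta. fold U. split; [|split; [|split; [|split; [|split]]]]; auto.
- constructor; [|constructor; [|constructor]]; now apply (is_solution_sub _ _ _ _ _ _ Hr').
- intros c Hc.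
  assert (Hc' : forall t x, U (t, x) -> c 0%nat * v1 t x + c 1%nat * v2 t x = 0).
  { intros t x Htx. specialize (Hc t x Htx). simpl in Hc.
    rewrite sum_Sn, sum_O in Hc. exact Hc. }
  assert (C0 : U (t0, x0)) by apply ball_center.
  assert (Hc0 := Hc' t0 x0 C0). rewrite Hv10, Hv20 in Hc0.
  (* The vanishing combination is differentiated in [x], which is legitimate since it vanishes on an
     open set; at the center the two relations then read off both constants. *)
  assert (Hc1 : c 0%nat * w1 t0 x0 + c 1%nat * w2 t0 x0 = 0).
  { destruct (E1 t0 x0 (Hr' _ C0)) as [<- _]. destruct (E2 t0 x0 (Hr' _ C0)) as [<- _].
    assert (HU0 : open U) by apply open_ball_box.
    transitivity (Derive (fun y => c 0%nat * v1 t0 y + c 1%nat * v2 t0 y) x0).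
    - symmetry. rewrite Derive_plus, !Derive_scal; [reflexivity | |];
      apply ex_derive_scal;
      [apply (proj1 S1 1%nat t0 x0 (Hr' _ C0)) | apply (proj1 S2 1%nat t0 x0 (Hr' _ C0))].
    - rewrite <- (Derive_const 0 x0). apply Derive_ext_loc.
      generalize (open_locally_x U t0 x0 HU0 C0). apply filter_imp. auto. }
  rewrite Hw10, Hw20 in Hc1.
  intros [|[|k]] Hk; [lra | lra | simpl in Hk; lia].
- exists (fun t x => - A t x). split; [|split].
  + apply smooth2_smoothN. intros k. apply smoothN_sub with (base Om); auto.
    now apply smoothN_opp.
  + intros t x Htx. apply Ropp_neq_0_compat. auto.
  + intros V u HV HVU [Hu Hueq] t x Htx. assert (Utx := HVU _ Htx).
    assert (HW2' := HW2 t x Utx). assert (HAn := A_neq0 t x (HU _ Utx)).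
    unfold lapply, darboux. simpl app. rewrite wronskian3.
    rewrite wronskian2 in HW2' |- *.
    destruct (HQt t x (HU _ Utx)) as [-> [-> ->]].
    (* Once [u_t] is eliminated by the equation, and the second derivatives of [v1] and [v2] by the
       system, a pointwise rational identity in [u], [u_x], [u_xx] is left, in which the Wronskian
       cancels. *)
    rewrite (Hueq t x Htx).
    change (Derive_n (fun y => u t y) 2 x) with (d_x (d_x u) t x).
    change (Derive (fun y => u t y) x) with (d_x u t x).
    destruct (E1 t x (Hr' _ Utx)) as [E11 E12]. destruct (E2 t x (Hr' _ Utx)) as [E21 E22].
    rewrite E12, E22. rewrite E11, E21 in *. unfold P, q. field. auto.
Qed.

End Darboux.

Theorem proposition5
  (A B C : R -> R -> R) (D : R * R -> Prop)
  (Om : R * R * R -> Prop) (Q : vfield) (Qt : lop)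
  (D_open : open D)
  (A_analytic : analytic2 D A)
  (B_analytic : analytic2 D B)
  (C_analytic : analytic2 D C)
  (A_neq0 : forall t x : R, D (t, x) -> A t x <> 0)
  (Om_open : open Om)
  (Om_over_D : forall t x u : R, Om (t, x, u) -> D (t, x))
  (Q_reduction : is_reduction_operator A B C Om Q)
  (Q_associated : associated Om Q Qt) :
  ((forall t x u : R, Om (t, x, u) -> tau Q t x u = 0) ->
     locally_darboux A B C (base Om) Qt 1) /\
  ((forall t x u : R, Om (t, x, u) -> tau Q t x u <> 0) ->
     locally_darboux A B C (base Om) Qt 2).
Proof.
assert (HD : forall p, base Om p -> D p).
{ intros [t x] [u Hu]. now apply Om_over_D with u. }
assert (Hs : forall f, analytic2 D f -> forall n, smoothN n (base Om) f).
{ intros f [Hf _] n. apply smoothN_sub with D; auto. now apply smooth2_smoothN. }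
assert (HA0 : forall t x, base Om (t, x) -> A t x <> 0) by (intros; auto).
destruct Q_associated as [[g1 [g2 [Hg1 [Hg2 [Heq HQt]]]]] | [eta1 [He [Heq HQt]]]];
  split; intros Htau.
(* A normal form that disagrees with the assumption on [tau] is refuted at any single point; the
   point comes from the goal, which is vacuous on an empty domain. *)
- intros t0 x0 [u0 H0]. exfalso.
  apply (equiv_coef_tau _ _ _ _ _ _ _ _ Heq H0) in Htau; auto. lra.
- apply darboux_two with Q g1 g2; auto.
- apply darboux_one with Q eta1; auto.
- intros t0 x0 [u0 H0]. exfalso. apply (Htau _ _ _ H0).
  now apply (equiv_coef_tau _ _ _ _ _ _ _ _ Heq H0).
Qed.
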